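(* Let $\alpha$ and $\beta$ be fixed real numbers with $\alpha$ positive, irrational, and of finite type. Then there is a constant $\kappa>0$ such that for all integers $N\geqslant 1$ and all integers $0\leqslant a<q\leqslant N^{\kappa}$ with $\gcd(a,q)=1$ we have $$\sum_{n\leqslant N}\Lambda\bigl(q\lfloor \alpha n+\beta\rfloor+a\bigr)=\alpha^{-1}\sum_{m\leqslant \lfloor \alpha N+\beta\rfloor}\Lambda(qm+a)+O\bigl(N^{1-\kappa}\bigr),$$ where the implied constant depends only on $\alpha$ and $\beta$.
   Context: The type of an irrational number $\alpha$ is $\tau=\sup\{\varrho\in\mathbb{R} : \liminf_{n\to\infty,\,n\in\mathbb{N}} n^{\varrho}\|\alpha n\|=0\}$, where $\|x\|$ is the distance from $x$ to the nearest integer; $\alpha$ is of finite type if $\tau<\infty$. $\Lambda$ is the von Mangoldt function: $\Lambda(n)=\log p$ if $n$ is a power of a prime $p$, and $\Lambda(n)=0$ otherwise (in particular $\Lambda(n)=0$ for $n\leqslant 1$). Sums over $n\leqslant N$ and $m\leqslant M$ range over positive integers. $\lfloor x\rfloor$ is the greatest integer $\leqslant x$. *)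

(* Defs.v *)
From mathcomp Require Import all_boot all_order all_algebra.
From mathcomp Require Import all_classical all_reals all_analysis.

Set Implicit Arguments.
Unset Strict Implicit.
Unset Printing Implicit Defensive.

Import Order.TTheory GRing.Theory Num.Theory.

Local Open Scope classical_set_scope.
Local Open Scope ring_scope.

Section Defs.
Context {R : realType}.

Definition dist_int (x : R) : R := inf [set `|x - m%:~R| | m in [set: int]].

(* The lower limit is taken in \bar R, as the sequence may be unbounded. *)
Definition irr_type (alpha : R) : \bar R :=
  ereal_sup [set rho%:E | rho in
    [set rho : R |
      limn_einf (fun n : nat =>
        (n%:R `^ rho * dist_int (alpha * n%:R))%:E) = 0%E]].

Definition finite_type (alpha : R) : Prop := (irr_type alpha < +oo)%E.

(* For 1 < n, n is a prime power exactly when it is a power of its smallest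
   prime divisor pdiv n; see von_mangoldtX and von_mangoldt0 below. *)
Definition von_mangoldt (z : int) : R :=
  if z is Posz n then
    if (1 < n)%N && (pdiv n).-nat n then ln (pdiv n)%:R else 0
  else 0.

Lemma von_mangoldtX (p k : nat) :
  prime p -> (0 < k)%N -> von_mangoldt (p ^ k)%N = ln p%:R.
Proof.
case: k => // k pp _.
have pdivE : pdiv (p ^ k.+1) = p by rewrite pdiv_pfactor.
rewrite /von_mangoldt pdivE pnatX pnat_id// andbT.
by rewrite -{1}(exp1n k.+1) ltn_exp2r// prime_gt1.
Qed.

Lemma von_mangoldt0 (z : int) :
  (forall p k : nat, prime p -> (0 < k)%N -> z <> (p ^ k)%N) ->
  von_mangoldt z = 0.
Proof.
case: z => // n nX; rewrite /von_mangoldt; case: ifP => // /andP[n1 pn].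
have pp := pdiv_prime n1; have [k nE] := p_natP pn.
case: k nE => [nE|k nE]; first by rewrite nE expn0 in n1.
by case: (nX _ k.+1 pp isT); congr Posz.
Qed.

End Defs.

(* Main.v *)
(* Put [g = 1 / alpha]. The number of [n] with [floor (alpha n + beta) = m] is
   [g + {g (beta - m - 1)} - {g (beta - m)}], so the theorem says that
   [Lambda (q m + a)] has, up to a power of [N], the same correlation with the
   fractional parts [{x - g m}] for every [x]. Replacing the fractional part by a
   Fejer-type average over the points [l / K] reduces this to a power saving in
   [sum Lambda n cos (2 pi n theta + phi)] with [theta = (k g + b) / q], [0 < k < K]
   and [K] a small power of [N]. As [alpha] has finite type [t], the distance from
   [n theta] to the integers is at least [N^-eps n^-t]. In Vaughan's identity the
   type I sums are then geometric sums whose ratio is far from 1, and the type II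
   sums are treated by the Cauchy-Schwarz inequality: the points [h theta], for
   [h] in a short interval, are well spaced, so few of them are close to integers.
   Any power saving is enough, hence all parameters are powers of
   [P = floor (N^kappa)] with [1 / kappa] a large integer. *)
Require Import Defs.
From mathcomp Require Import all_boot all_order all_algebra.
From mathcomp Require Import all_classical all_reals all_analysis.
From mathcomp Require Import ring lra zify.

Import Order.TTheory GRing.Theory Num.Theory numFieldNormedType.Exports.

Local Open Scope ring_scope.

(** * Trigonometric sums in units of a full turn *)

Section Trigonometric.
Context {R : realType}.
Implicit Types (x y phi d : R) (m n k : nat) (z h : int).

(** The frequency [k] is never 0, so finite type keeps every [theta] on the minor arcs and each
    frequency yields a power saving. The frequency 0 contributes the total weight times the mean of
    the points [l / K]. This does not depend on [x], so it cancels between the two fractional parts,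
    at [x = g beta] and [x = g (beta - 1)]. Only real cosines occur. Bounds uniform in the phase
    [phi] also cover sines, the shift by a residue class and the translates of the kernel. Every
    logarithm is replaced by a constant times [P], since [N] is a fixed power of [N^kappa < P + 1].
    The estimates then hold for every [N >= 1] with no threshold, and a logarithm costs one power of
    [P]. In Vaughan's identity all variables run over [1 .. X], and the cut-off sits in a test
    function that vanishes beyond [X]. Dirichlet convolutions thus become interchanges of finite
    sums over fixed ranges. *)

Definition tcos x : R := cos (2 * pi * x).
Definition tsin x : R := sin (2 * pi * x).
(** A lower bound for the distance to the nearest integer, stated without an infimum so that each
    use handles a single integer. *)
Definition far d x := forall z, d <= `|x - z%:~R|.
Definition fpart x : R := x - (Num.floor x)%:~R.

Lemma sin_int z x : `|sin (pi * (x - z%:~R))| = `|sin (pi * x)|.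
Proof.
have H n y : `|sin (pi * (y - n%:R))| = `|sin (pi * y)| :> R.
  elim: n y => [|n IH] y; first by rewrite subr0.
  rewrite -(IH y) -[in LHS]normrN -sinDpi; congr (`|sin _|).
  by rewrite -natr1; ring.
case: z => n; first exact: H.
by rewrite -[x in RHS](addrK (n.+1%:R : R)) H NegzE rmorphN opprK.
Qed.

Lemma tcosDn x n : tcos (x + n%:R) = tcos x.
Proof.
elim: n => [|n IH]; first by rewrite addr0.
rewrite -IH /tcos -[in RHS]cosD2pi; congr cos.
by rewrite -natr1 (mulr2n pi); ring.
Qed.

Lemma tsinDn x n : tsin (x + n%:R) = tsin x.
Proof.
elim: n => [|n IH]; first by rewrite addr0.
rewrite -IH /tsin -[in RHS]sinD2pi; congr sin.
by rewrite -natr1 (mulr2n pi); ring.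
Qed.

Lemma tcosDz x z : tcos (x + z%:~R) = tcos x.
Proof.
case: z => n; first exact: tcosDn.
by rewrite NegzE rmorphN /= -[LHS](tcosDn _ n.+1) subrK.
Qed.

Lemma tsinDz x z : tsin (x + z%:~R) = tsin x.
Proof.
case: z => n; first exact: tsinDn.
by rewrite NegzE rmorphN /= -[LHS](tsinDn _ n.+1) subrK.
Qed.

Lemma tcosN x : tcos (- x) = tcos x.
Proof. by rewrite /tcos mulrN cosN. Qed.

Lemma tcos0 : tcos 0 = 1.
Proof. by rewrite /tcos mulr0 cos0. Qed.

Lemma tcos_norm_le1 x : `|tcos x| <= 1.
Proof. exact: cos_max. Qed.

Lemma tcosB x y : tcos (x - y) = tcos x * tcos y + tsin x * tsin y.
Proof. by rewrite /tcos mulrBr cosB. Qed.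

Lemma cos_sqr_ge_half x : 0 <= x <= pi / 4 -> 1 / 2 <= cos x ^+ 2.
Proof.
move=> /andP[x0 xpi]; have pi0 : 0 < (pi : R) := pi_gt0 R.
have : 0 <= cos (x *+ 2).
  by apply: cos_ge0_pihalf; rewrite (mulr2n x); apply/andP; split; lra.
by rewrite cos_mulr2n (mulr2n (_ ^+ 2)); lra.
Qed.

(** A weak Jordan inequality. The mean value theorem gives [sin (x / 2) = (x / 2) cos c], so
    [sin x = x cos (x / 2) cos c], and both angles are at most [pi / 4]. *)
Lemma sin_ge_half x : 0 <= x <= pi / 2 -> x / 2 <= sin x.
Proof.
move=> /andP[x0 xpi].
have pi0 : 0 < (pi : R) := pi_gt0 R.
have [-> | xN0] := eqVneq x 0; first by rewrite sin0 mul0r.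
have xp : 0 < x by rewrite lt0r xN0.
have x2 : 0 < x / 2 by lra.
have [|c] := @MVT R sin cos 0 (x / 2) x2.
  by apply: continuous_subspaceT => y; exact: continuous_sin.
rewrite in_itv /= => /andP[c0 cx].
rewrite sin0 !subr0 => E.
rewrite [X in sin X](_ : x = (x / 2) *+ 2); last by rewrite (mulr2n (x / 2)); lra.
rewrite sin_mulr2n E.
have cc : 0 <= cos c by apply: cos_ge0_pihalf; apply/andP; split; lra.
have cx2 : 0 <= cos (x / 2) by apply: cos_ge0_pihalf; apply/andP; split; lra.
have hc : 1 / 2 <= cos c ^+ 2 by apply: cos_sqr_ge_half; apply/andP; split; lra.
have hx : 1 / 2 <= cos (x / 2) ^+ 2 by apply: cos_sqr_ge_half; apply/andP; split; lra.
have : 1 / 2 <= cos (x / 2) * cos c.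
  have pq : 0 <= cos (x / 2) * cos c by apply: mulr_ge0.
  have : 1 / 4 <= (cos (x / 2) * cos c) ^+ 2 by rewrite exprMn; nra.
  by nra.
rewrite (mulr2n (_ * _)) => H; nra.
Qed.

(** Subtracting the nearest integer [floor (x + 1 / 2)] brings [x] to some [y] in [[-1/2, 1/2]].
    There [sin_ge_half] gives [pi |y| / 2], which is at least [|y|] as [pi >= 2]. *)
Lemma far_sin d x : 0 <= d -> far d x -> d <= `|sin (pi * x)|.
Proof.
move=> d0 /(_ (Num.floor (x + 1 / 2))); set z := Num.floor _ => dx.
rewrite -(sin_int z); set y := x - _ in dx *.
have pi2 : 2 <= (pi : R) := pi_ge2 R.
have /andP[y1 y2] : - (1 / 2) <= y <= 1 / 2.
  have := floor_le (x + 1 / 2); have := floorD1_gt (x + 1 / 2).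
  by rewrite -/z rmorphD /= /y => ? ?; apply/andP; split; lra.
have -> : `|sin (pi * y)| = `|sin (pi * `|y|)|.
  by case: (ger0P y) => // _; rewrite mulrN sinN normrN.
apply: le_trans dx _.
have ny : `|y| <= 1 / 2 by rewrite ler_norml; apply/andP; split; lra.
have y0 : 0 <= `|y| by [].
apply: le_trans (ler_norm _).
apply: le_trans (sin_ge_half _ _); [nra | apply/andP; split; nra].
Qed.

Lemma far_le d e x : d <= e -> far e x -> far d x.
Proof. by move=> de xe z; apply: le_trans de (xe z). Qed.


(** The real form of the geometric sum: multiplied by [2 sin (pi x)], each cosine becomes a
    difference of sines half a step apart. *)
Lemma sum_tcosE x phi m n : (m <= n)%N ->
  2 * sin (pi * x) * \sum_(m <= k < n) tcos (k%:R * x + phi) =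
  tsin ((n%:R - 1 / 2) * x + phi) - tsin ((m%:R - 1 / 2) * x + phi).
Proof.
move=> mn; rewrite mulr_sumr.
rewrite (telescope_sumr_eq (fun k => tsin ((k%:R - 1 / 2) * x + phi)))//.
move=> k _; rewrite /tsin /tcos.
rewrite (_ : 2 * pi * ((k.+1%:R - 1 / 2) * x + phi) =
  2 * pi * (k%:R * x + phi) + pi * x); last by rewrite -natr1; field.
rewrite (_ : 2 * pi * ((k%:R - 1 / 2) * x + phi) =
  2 * pi * (k%:R * x + phi) - pi * x); last by field.
by rewrite sinD sinB; ring.
Qed.

Lemma sum_tcos_le d x phi m n : 0 < d -> far d x ->
  `|\sum_(m <= k < n) tcos (k%:R * x + phi)| <= d^-1.
Proof.
move=> d0 xd; have [mn|nm] := leqP m n; last first.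
  by rewrite big_geq ?normr0 ?invr_ge0 ?ltW// (ltnW nm).
have sd : d <= `|sin (pi * x)| by apply: far_sin => //; exact: ltW.
have := sum_tcosE x phi m n mn; set S := \sum_(_ <= _ < _) _.
move=> /(congr1 Num.norm); rewrite !normrM => E.
have : `|2 : R| * `|sin (pi * x)| * `|S| <= 2.
  rewrite E; apply: le_trans (ler_normB _ _) _.
  by have := sin_max (2 * pi * ((n%:R - 1 / 2) * x + phi));
     have := sin_max (2 * pi * ((m%:R - 1 / 2) * x + phi)); rewrite /tsin; lra.
rewrite ger0_norm// => H.
rewrite -[d^-1]mul1r ler_pdivlMr//.
have := normr_ge0 S; nra.
Qed.

Lemma far_ratio z n : (0 < n)%N -> ~~ (n %| z)%Z -> far n%:R^-1 (z%:~R / n%:R).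
Proof.
move=> n0 nz w; have n0' : 0 < n%:R :> R by rewrite ltr0n.
rewrite -(@ler_pM2r _ n%:R)// mulVf ?gt_eqF// -[X in _ * X]gtr0_norm//.
rewrite -normrM mulrBl mulfVK ?gt_eqF// -[n%:R]/((n%:Z)%:~R) -intrM -intrB.
rewrite -intr_norm (ler_int _ 1).
suff : z - w * n != 0 by rewrite -normr_gt0; lia.
by apply: contra nz; rewrite subr_eq0 => /eqP ->; rewrite dvdz_mull.
Qed.

(** Orthogonality of additive characters: over a full period the two end terms of [sum_tcosE] differ
    by the integer [z], hence cancel. *)
Lemma sum_tcos0 z n phi : (0 < n)%N -> ~~ (n %| z)%Z ->
  \sum_(0 <= k < n) tcos (k%:R * (z%:~R / n%:R) + phi) = 0.
Proof.
move=> n0 nz; have n0' : n%:R != 0 :> R by rewrite pnatr_eq0 -lt0n.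
have sd : n%:R^-1 <= `|sin (pi * (z%:~R / n%:R))| :> R.
  by apply: far_sin (far_ratio _ _ _ _); rewrite ?invr_ge0.
have := sum_tcosE (z%:~R / n%:R) phi 0 n isT.
rewrite (_ : (n%:R - 1 / 2) * (z%:~R / n%:R) + phi =
  (0%:R - 1 / 2) * (z%:~R / n%:R) + phi + z%:~R); last by field.
rewrite tsinDz subrr => /eqP; rewrite !mulf_eq0 pnatr_eq0 /= => /orP[/eqP s0|/eqP//].
by move: sd; rewrite s0 normr0 leNgt invr_gt0 ltr0n n0.
Qed.

(** Abel summation: [g k] is [g 0] plus its nonnegative jumps below [k], so the sum is a combination
    of tails of [u] with nonnegative coefficients of total [g n]. *)
Lemma abel_le (g u : nat -> R) d n : 0 <= g 0%N ->
  {homo g : i j / (i <= j)%N >-> i <= j} ->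
  (forall m, `|\sum_(m <= k < n.+1) u k| <= d) ->
  `|\sum_(1 <= k < n.+1) g k * u k| <= d * g n.
Proof.
move=> g0 gmono ud.
have gE k : g k = g 0%N + \sum_(0 <= j < n) (g j.+1 - g j) * (j < k)%:R +
    (if (n < k)%N then g k - g n else 0).
  case: ltnP => nk.
    rewrite (eq_big_nat _ _ (F2 := fun j => g j.+1 - g j)); last first.
      by move=> j /andP[_ jn]; rewrite (ltn_trans jn nk) mulr1.
    by rewrite telescope_sumr//; ring.
  rewrite (big_cat_nat (n := k))//=.
  rewrite (eq_big_nat _ _ (F2 := fun j => g j.+1 - g j)); last first.
    by move=> j /andP[_ ->]; rewrite mulr1.
  rewrite telescope_sumr// big_nat big1 ?addr0; first by ring.
  by move=> j /andP[kj _]; rewrite ltnNge kj mulr0.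
have -> : \sum_(1 <= k < n.+1) g k * u k =
   g 0%N * \sum_(1 <= k < n.+1) u k +
   \sum_(0 <= j < n) (g j.+1 - g j) * \sum_(j.+1 <= k < n.+1) u k.
  rewrite [X in _ = _ + X](eq_bigr (fun j => \sum_(1 <= k < n.+1)
      (g j.+1 - g j) * (if (j < k)%N then u k else 0))); last first.
    by move=> j _; rewrite (big_nat_widenl j.+1 1%N)//= big_mkcond /= mulr_sumr.
  rewrite exchange_big /= mulr_sumr -big_split /=; apply: eq_big_nat => k /andP[_ kn].
  rewrite [g k in LHS]gE ltnNge -ltnS kn /= addr0 mulrDl mulr_suml; congr +%R.
  by apply: eq_bigr => j _; case: ltnP => _; rewrite ?(mulr1, mulr0, mul0r).
apply: le_trans (ler_normD _ _) _; rewrite normrM ger0_norm//.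
have -> : d * g n = g 0%N * d + \sum_(0 <= j < n) (g j.+1 - g j) * d.
  by rewrite -mulr_suml telescope_sumr//; ring.
apply: lerD; first exact: ler_wpM2l.
apply: le_trans (ler_norm_sum _ _ _) _; apply: ler_sum => j _.
have gj : 0 <= g j.+1 - g j by rewrite subr_ge0 gmono.
by rewrite normrM ger0_norm// ler_wpM2l.
Qed.

End Trigonometric.

(** * The Moebius and von Mangoldt functions *)

Section Arithmetic.
Context {R : realType}.
Implicit Types (n m k d p X U : nat) (F H a : nat -> R).

Definition mobius n : R :=
  if all (fun p => logn p n == 1%N) (primes n) then (-1) ^+ size (primes n)
  else 0.

Lemma mobius_norm_le1 n : `|mobius n| <= 1.
Proof.
by rewrite /mobius; case: ifP => _; rewrite ?normr0// normrX normrN1 expr1n.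
Qed.

Lemma mobiusM_dvd p d : prime p -> (0 < d)%N -> (p %| d)%N -> mobius (p * d) = 0.
Proof.
move=> pp d0 pd; rewrite /mobius ifF//; apply/negP => /allP/(_ p).
have p0 := prime_gt0 pp.
rewrite mem_primes pp muln_gt0 p0 d0 dvdn_mulr// lognM// logn_prime// eqxx.
have : (0 < logn p d)%N by rewrite logn_gt0 mem_primes pp d0.
by move=> v0 /(_ isT) /eqP; lia.
Qed.

Lemma mobiusM p d : prime p -> (0 < d)%N -> ~~ (p %| d)%N ->
  mobius (p * d) = - mobius d.
Proof.
move=> pp d0 pd; have p0 := prime_gt0 pp.
have pE : perm_eq (primes (p * d)) (p :: primes d).
  apply: uniq_perm; rewrite /= ?primes_uniq ?andbT//.
    by rewrite mem_primes pp d0.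
  by move=> r; rewrite primesM// primes_prime// inE.
have vd : logn p d = 0%N by apply/eqP; rewrite -leqn0 leqNgt logn_gt0 mem_primes pp d0.
rewrite /mobius (perm_all _ pE) (perm_size pE) /= lognM// logn_prime// eqxx vd /=.
rewrite (eq_in_all (a2 := fun r => logn r d == 1%N)); last first.
  move=> r rd /=; rewrite lognM// logn_prime// (_ : (r == p) = false)//.
  by apply: contraNF pd => /eqP <-; move: rd; rewrite mem_primes => /and3P[].
by case: ifP => _; rewrite ?oppr0// exprS mulN1r.
Qed.

(** As [H] vanishes beyond [X], the cofactor [l] may run up to [X] rather than [X / d], which keeps
    the range independent of [d]. *)
Lemma sum_multiples X d H : (0 < d)%N -> (forall n, (X < n)%N -> H n = 0) ->
  \sum_(1 <= n < X.+1 | (d %| n)%N) H n = \sum_(1 <= l < X.+1) H (d * l)%N.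
Proof.
move=> d0 HX.
have E l : (1 <= l < X.+1)%N ->
    H (d * l)%N = \sum_(1 <= n < X.+1) (if n == (d * l)%N then H n else 0).
  move=> /andP[l0 lX]; rewrite -big_mkcond big_nat1_eq; case: ifPn => //.
  by rewrite muln_gt0 d0 l0 /= ltnS -ltnNge => /HX.
rewrite [RHS](eq_big_nat _ _ E) exchange_big /= big_mkcond.
apply: eq_big_nat => n /andP[n0 nX]; case: ifPn => dn.
  rewrite (eq_bigr (fun l => if l == (n %/ d)%N then H n else 0)); last first.
    move=> l _; congr (if _ then _ else _).
    by rewrite eqn_div// [(d * l)%N]mulnC eq_sym.
  rewrite -big_mkcond big_nat1_eq divn_gt0// dvdn_leq//= ltnS ifT//.
  by apply: leq_trans (leq_div _ _) _.
rewrite big1// => l _; case: eqP => // nE.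
by rewrite nE dvdn_mulr in dn.
Qed.

Lemma sum_divisors X a H : (forall n, (X < n)%N -> H n = 0) ->
  \sum_(1 <= d < X.+1) \sum_(1 <= l < X.+1) a d * H (d * l)%N =
  \sum_(1 <= n < X.+1) (\sum_(1 <= d < X.+1 | (d %| n)%N) a d) * H n.
Proof.
move=> HX.
under [RHS]eq_bigr do rewrite mulr_suml big_mkcond.
rewrite [RHS]exchange_big /=; apply: eq_big_nat => d /andP[d0 _].
rewrite -mulr_sumr -sum_multiples// mulr_sumr big_mkcond.
by apply: eq_bigr.
Qed.

(** For [n = p m] with [p] prime, divisors [d] prime to [p] cancel against [p d], and [mobius]
    vanishes at multiples of [p ^ 2]. *)
Lemma sum_mobius X n : (0 < n <= X)%N ->
  \sum_(1 <= d < X.+1 | (d %| n)%N) mobius d = (n == 1%N)%:R.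
Proof.
case/andP => n0 nX; have [->|n1] := eqVneq n 1%N.
  rewrite (eq_bigl (pred1 1%N)); last by move=> d; rewrite /= dvdn1.
  by rewrite big_nat1_eq /= ltnS (leq_trans n0)// /mobius /= expr0.
have pp : prime (pdiv n) by rewrite pdiv_prime// ltn_neqAle eq_sym n1.
set p := pdiv n in pp; have p0 := prime_gt0 pp.
have [m nE] := dvdnP (pdiv_dvd n); rewrite -/p mulnC in nE.
have m0 : (0 < m)%N by move: n0; rewrite nE muln_gt0 => /andP[].
rewrite (bigID (fun d => (p %| d)%N)) /=.
have -> : \sum_(1 <= d < X.+1 | (d %| n)%N && (p %| d)%N) mobius d =
    \sum_(1 <= d < X.+1 | (d %| m)%N) mobius (p * d).
  rewrite (eq_bigl (fun d => (p %| d)%N && (d %| n)%N)); last first.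
    by move=> d; rewrite andbC.
  rewrite big_mkcondr sum_multiples//; last first.
    by move=> d Xd; case: ifP => // /(dvdn_leq n0); lia.
  by rewrite -big_mkcond /=; apply: eq_bigl => d; rewrite nE dvdn_pmul2l.
rewrite [X in X + _](bigID (fun d => (p %| d)%N)) /= big1_seq ?add0r; last first.
  move=> d; rewrite mem_index_iota => /andP[/andP[_ pd] /andP[d0 _]].
  exact: mobiusM_dvd.
rewrite [X in _ + X](eq_bigl (fun d => (d %| m)%N && ~~ (p %| d)%N)); last first.
  move=> d; case pd: (p %| d)%N; rewrite ?andbF// !andbT nE Gauss_dvdr//.
  by rewrite coprime_sym prime_coprime// pd.
rewrite -big_split /= big1_seq// => d.
rewrite mem_index_iota => /andP[/andP[_ pd] /andP[d0 _]].
by rewrite mobiusM// addNr.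
Qed.

Definition mangoldt n : R := von_mangoldt n%:Z.

Lemma mangoldtX p k : prime p -> mangoldt (p ^ k.+1) = ln p%:R.
Proof. by move=> pp; rewrite /mangoldt von_mangoldtX. Qed.

Lemma mangoldtP n : mangoldt n = 0 \/
  exists p k, [/\ prime p, n = (p ^ k.+1)%N & mangoldt n = ln p%:R].
Proof.
rewrite /mangoldt /=; case: ifP; last by left.
move=> /andP[n1 pn]; right; have pp := pdiv_prime n1.
have [[|k] nE] := p_natP pn; first by rewrite nE in n1.
by exists (pdiv n), k.
Qed.

Lemma mangoldt_ge0 n : 0 <= mangoldt n.
Proof.
have [->//|[p [k [pp _ ->]]]] := mangoldtP n.
by apply: ln_ge0; rewrite ler1n prime_gt0.
Qed.

Lemma mangoldt_le n : (0 < n)%N -> mangoldt n <= ln n%:R.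
Proof.
move=> n0; have [->//|[p [k [pp nE ->]]]] := mangoldtP n.
  by apply: ln_ge0; rewrite ler1n.
rewrite ler_ln ?posrE ?ltr0n//; last exact: prime_gt0.
by rewrite ler_nat nE expnS leq_pmulr// expn_gt0 prime_gt0.
Qed.

(** Induction on [n = p m]: among the divisors of [n] that do not divide [m], the only prime power
    is [p ^ (v + 1)] with [v = logn p m]. It accounts for [ln p]. *)
Lemma sum_mangoldt X n : (0 < n <= X)%N ->
  \sum_(1 <= d < X.+1 | (d %| n)%N) mangoldt d = ln n%:R.
Proof.
elim/ltn_ind: n => n IH /andP[n0 nX]; have [->|n1] := eqVneq n 1%N.
  rewrite (eq_bigl (pred1 1%N)); last by move=> d; rewrite /= dvdn1.
  by rewrite big_nat1_eq ln1 /mangoldt /=; case: ifP.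
have pp : prime (pdiv n) by rewrite pdiv_prime// ltn_neqAle eq_sym n1.
set p := pdiv n in pp; have p0 := prime_gt0 pp; have p1 := prime_gt1 pp.
have [m nE] := dvdnP (pdiv_dvd n); rewrite -/p mulnC in nE.
have m0 : (0 < m)%N by move: n0; rewrite nE muln_gt0 => /andP[].
have mn : (m < n)%N by rewrite nE ltn_Pmull.
rewrite (bigID (fun d => (d %| m)%N)) /=.
rewrite (eq_bigl (fun d => (d %| m)%N)); last first.
  move=> d; case dm: (d %| m)%N; rewrite ?andbF// andbT nE.
  exact: dvdn_mull.
rewrite IH ?m0 ?(leq_trans (ltnW mn))//.
set v := logn p m.
rewrite big_mkcond.
rewrite (eq_big_nat _ _
  (F2 := fun d => if d == (p ^ v.+1)%N then ln p%:R else 0)); last first.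
  move=> d /andP[d0 _]; case: eqP => [->|dv].
    rewrite ifT ?mangoldtX// nE expnS dvdn_pmul2l// pfactor_dvdn// leqnn /=.
    by rewrite -expnS pfactor_dvdn// ltnn.
  case: ifP => // /andP[dn dm].
  have [//|[r [k [rp dE _]]]] := mangoldtP d; exfalso.
  have [rE|rN] := eqVneq r p; last first.
    move: dn dm; rewrite dE nE Gauss_dvdr; first by move=> ->.
    by rewrite coprimeXl// prime_coprime// dvdn_prime2.
  subst r; move: dn dm; rewrite dE nE expnS dvdn_pmul2l// -expnS !pfactor_dvdn//.
  move=> kv vk; apply: dv; rewrite dE; congr (_ ^ _)%N.
  by apply/eqP; rewrite eqn_leq; rewrite -/v in kv vk *; lia.
rewrite -big_mkcond big_nat1_eq ifT; last first.
  rewrite expn_gt0 p0 /= ltnS (leq_trans _ nX)// nE expnS leq_mul2l.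
  by rewrite dvdn_leq ?orbT// pfactor_dvdnn.
rewrite nE natrM lnM ?posrE ?ltr0n//; exact: addrC.
Qed.

(** The inner coefficient in Vaughan's identity. For [0 < k <= X] it does not depend on [X], which
    only bounds the range of [m]. *)
Definition mangoldt_tail X U k : R :=
  \sum_(1 <= m < X.+1 | (m %| k)%N) if (U < m)%N then mangoldt m else 0.

Lemma mangoldt_tail_ge0 X U k : 0 <= mangoldt_tail X U k.
Proof. by apply: sumr_ge0 => m _; case: ifP => // _; exact: mangoldt_ge0. Qed.

Lemma mangoldt_tailE X U k : (0 < k <= X)%N -> mangoldt_tail X U k =
  ln k%:R - \sum_(1 <= m < X.+1 | (m %| k)%N) if (m <= U)%N then mangoldt m else 0.
Proof.
move=> kX; rewrite -(sum_mangoldt _ _ kX) -sumrB; apply: eq_bigr => m _.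
by case: leqP; rewrite ?subrr ?subr0.
Qed.

Lemma mangoldt_tail_le X U k : (0 < k <= X)%N -> mangoldt_tail X U k <= ln k%:R.
Proof.
move=> kX; rewrite mangoldt_tailE// gerBl.
by apply: sumr_ge0 => m _; case: ifP => // _; exact: mangoldt_ge0.
Qed.

Lemma mangoldt_tail_eq0 X U k : (0 < k <= U)%N -> mangoldt_tail X U k = 0.
Proof.
move=> /andP[k0 kU]; apply: big1 => m /(dvdn_leq k0) mk.
by rewrite ltnNge (leq_trans mk).
Qed.

(* With [1 * mu = delta], the tail of [Lambda] is [mu * (1 * Lambda_{> U})]. *)
Lemma sum_mangoldt_tail X U F : (forall n, (X < n)%N -> F n = 0) ->
  \sum_(1 <= n < X.+1) (if (U < n)%N then mangoldt n else 0) * F n =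
  \sum_(1 <= d < X.+1) mobius d *
    \sum_(1 <= k < X.+1) mangoldt_tail X U k * F (d * k)%N.
Proof.
move=> FX; pose L n := if (U < n)%N then mangoldt n else 0.
have FX' d n : (0 < d)%N -> (X < n)%N -> F (d * n)%N = 0.
  by move=> d0 Xn; apply: FX; nia.
transitivity (\sum_(1 <= m < X.+1) \sum_(1 <= d < X.+1) \sum_(1 <= l < X.+1)
   L m * (mobius d * F (m * (d * l))%N)).
  apply: eq_big_nat => m /andP[m0 mX].
  under eq_bigr do rewrite -mulr_sumr.
  rewrite -mulr_sumr; congr (_ * _).
  rewrite (sum_divisors X mobius (fun n => F (m * n)%N)); last first.
    by move=> n; exact: FX'.
  under eq_big_nat => n /andP[n0 nX].
    rewrite sum_mobius ?n0//.
    rewrite (_ : _ * _ = if n == 1%N then F (m * n)%N else 0); last first.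
      by case: eqP; rewrite ?mul1r ?mul0r.
    over.
  by rewrite -big_mkcond big_nat1_eq muln1 /= ltnS (leq_trans m0 mX).
rewrite exchange_big /=; apply: eq_big_nat => d /andP[d0 dX].
rewrite -(sum_divisors X L (fun n => F (d * n)%N)); last first.
  by move=> n; exact: FX'.
rewrite mulr_sumr; apply: eq_bigr => m _; rewrite mulr_sumr.
by apply: eq_bigr => l _; rewrite mulrCA mulnCA.
Qed.

(** The form used for small [d]: by [1 * Lambda = ln], the long variable carries only the smooth
    weights [ln k] and 1, and the arithmetic weight has [m <= U]. *)
Lemma sum_mangoldt_tail_typeI X U d F : (0 < d)%N ->
  (forall n, (X < n)%N -> F n = 0) ->
  \sum_(1 <= k < X.+1) mangoldt_tail X U k * F (d * k)%N =
  \sum_(1 <= k < X.+1) ln k%:R * F (d * k)%N -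
  \sum_(1 <= m < X.+1) (if (m <= U)%N then mangoldt m else 0) *
    \sum_(1 <= l < X.+1) F (d * m * l)%N.
Proof.
move=> d0 FX.
under [X in _ = _ - X]eq_bigr do rewrite mulr_sumr.
under [X in _ = _ - X]eq_bigr do under eq_bigr do rewrite -mulnA.
rewrite (sum_divisors X (fun m => if (m <= U)%N then mangoldt m else 0)
  (fun n => F (d * n)%N)); last by move=> n Xn; apply: FX; nia.
rewrite -sumrB; apply: eq_big_nat => k /andP[k0 kX].
by rewrite mangoldt_tailE ?k0// mulrBl.
Qed.

End Arithmetic.

(** * Exponential sums over primes *)

Section ExponentialSum.
Context {R : realType}.
Implicit Types (theta phi d l t : R) (X U V L k h n m : nat).

(** Pigeonhole: [h |-> h %/ L] is injective on the points satisfying [P]. *)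
Lemma spaced_count_le (P : pred nat) L k : (0 < L)%N ->
  (forall h h', P h -> P h' -> (h < h')%N -> (h + L < h')%N) ->
  (\sum_(0 <= h < k) P h <= (k %/ L).+1)%N.
Proof.
move=> L0 PL; rewrite big_mkord.
pose A := [set h : 'I_k | P h].
have -> : (\sum_(h < k) P h = #|A|)%N.
  rewrite -sum1_card [RHS]big_mkcond /=; apply: eq_bigr => h _.
  by rewrite inE; case: (P h).
pose f (h : 'I_k) : 'I_(k %/ L).+1 := inord (h %/ L).
have fE (h : 'I_k) : f h = (h %/ L)%N :> nat by rewrite inordK// ltnS leq_div2r// ltnW.
have lt_f (h h' : 'I_k) : h \in A -> h' \in A -> (h < h')%N -> f h <> f h'.
  rewrite !inE => Ph Ph' /(PL _ _ Ph Ph') hh' /(congr1 val) /=.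
  rewrite !fE => E; suff : (h %/ L < h' %/ L)%N by rewrite E ltnn.
  by rewrite leq_divRL// mulSnr (leq_trans _ (ltnW hh'))// leq_add2r leq_trunc_div.
rewrite -(@card_in_imset _ _ f) => [|h h' hA h'A fh].
  by rewrite -[X in (_ <= X)%N]card_ord max_card.
apply: val_inj => /=; case: (ltngtP h h') => // hh'.
  by case: (lt_f _ _ hA h'A hh').
by case: (lt_f _ _ h'A hA hh').
Qed.

Lemma sum_inv_le X : (0 < X)%N ->
  \sum_(1 <= k < X.+1) (k%:R^-1 : R) <= 1 + ln X%:R.
Proof.
elim: X => // -[_ _|X IH _]; first by rewrite big_nat1 invr1 ln1 addr0.
rewrite big_nat_recr//=.
apply: le_trans (lerD (IH isT) (lexx _)) _; rewrite -addrA lerD2l.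
have X2 : 0 < X.+2%:R :> R by [].
have X1 : 0 < X.+1%:R :> R by [].
have := @le_ln1Dx R (- X.+2%:R^-1).
rewrite (_ : 1 + - X.+2%:R^-1 = X.+1%:R / X.+2%:R :> R); last first.
  by rewrite -[X.+2%:R]natr1; field; rewrite -natr1 in X2 *; rewrite gt_eqF.
rewrite ln_div ?posrE// => H.
have {H} : ln X.+1%:R - ln X.+2%:R <= - X.+2%:R^-1 :> R.
  by apply: H; rewrite ltrN2 invf_lt1// (ltr_nat _ 1).
by move: (_^-1) => u; lra.
Qed.

Lemma sum_inv_sqr_le U X : (0 < U)%N ->
  \sum_(1 <= k < X.+1) (if (U < k)%N then k%:R^-1 ^+ 2 else 0 : R) <= U%:R^-1.
Proof.
move=> U0; have U0' : 0 < U%:R :> R by rewrite ltr0n.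
have [XU|UX] := leqP X U.
  rewrite big_nat big1 ?invr_ge0 ?ltW// => k /andP[_ kX].
  by rewrite ltnNge (leq_trans _ XU).
rewrite -big_mkcond /=.
rewrite (eq_bigl (fun k => true && (U < k)%N))// -big_nat_widenl//.
apply: (@le_trans _ _ (U%:R^-1 - X%:R^-1)); last by rewrite gerBl invr_ge0.
have -> : U%:R^-1 - X%:R^-1 =
    \sum_(U.+1 <= k < X.+1) (k.-1%:R^-1 - k%:R^-1) :> R.
  rewrite (telescope_sumr_eq (fun k => - k.-1%:R^-1)) /=; first by ring.
    by rewrite ltnS ltnW.
  by move=> k _ /=; ring.
apply: ler_sum_nat => k /andP[Uk _].
case: k Uk => [|k] //= Uk; have k0 : 0 < k%:R :> R by rewrite ltr0n (leq_trans U0).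
rewrite -subr_ge0.
rewrite (_ : _ - _ = k%:R^-1 * k.+1%:R^-1 ^+ 2 :> R).
  by rewrite mulr_ge0 ?sqr_ge0 ?invr_ge0 ?ltW.
by rewrite -natr1; field; rewrite !gt_eqF// ltr_wpDl ?ltW.
Qed.

Lemma sum_cut X n (z : nat -> R) : (0 < n)%N ->
  \sum_(1 <= k < X.+1) (if (n * k <= X)%N then z k else 0) =
  \sum_(1 <= k < (X %/ n).+1) z k.
Proof.
move=> n0; rewrite -big_mkcond [RHS](big_nat_widen _ _ X.+1) /=; last first.
  by rewrite ltnS leq_div.
by apply: eq_bigl => k; rewrite ltnS leq_divRL// mulnC.
Qed.

(** The cut-off is part of the function so that it vanishes beyond [X], as the convolution lemmas
    require. *)
Definition wave theta phi X n : R :=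
  if (n <= X)%N then tcos (n%:R * theta + phi) else 0.

Lemma wave_eq0 theta phi X n : (X < n)%N -> wave theta phi X n = 0.
Proof. by rewrite /wave ltnNge; case: leqP. Qed.

Lemma sum_wave_le theta phi X n d : (0 < n)%N -> 0 < d -> far d (n%:R * theta) ->
  `|\sum_(1 <= k < X.+1) wave theta phi X (n * k)| <= d^-1.
Proof.
move=> n0 d0 nd; rewrite (sum_cut _ _ (fun k => tcos ((n * k)%:R * theta + phi)))//.
under eq_bigr => k _ do rewrite mulnC natrM -mulrA.
exact: sum_tcos_le.
Qed.

Lemma sum_ln_wave_le theta phi X n d : (0 < n)%N -> (0 < X)%N ->
  0 < d -> far d (n%:R * theta) ->
  `|\sum_(1 <= k < X.+1) ln k%:R * wave theta phi X (n * k)| <= ln X%:R / d.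
Proof.
(* [maxn 1 k] keeps the argument of [ln] positive at [k = 0], so that [g] is nondecreasing on all of
   [nat], as [abel_le] asks. *)
move=> n0 X0 d0 nd; pose g k : R := ln (maxn 1 k)%:R.
under eq_big_nat => k /andP[k0 _].
  rewrite (_ : _ * _ = if (n * k <= X)%N then
    g k * tcos (k%:R * (n%:R * theta) + phi) else 0); last first.
    rewrite /g (maxn_idPr k0) /wave; case: ifP; rewrite ?mulr0//.
    by rewrite mulnC natrM mulrA.
  over.
rewrite sum_cut//; apply: (@le_trans _ _ (d^-1 * g (X %/ n)%N)).
  apply: abel_le => [||m]; last exact: sum_tcos_le.
    by rewrite /g ln_ge0.
  move=> i j ij; rewrite /g ler_ln ?posrE ?ltr0n ?leq_max// ler_nat.
  by rewrite geq_max leq_max/= leq_max ij orbT.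
rewrite mulrC ler_wpM2r ?invr_ge0 ?(ltW d0)// /g ler_ln ?posrE ?ltr0n ?leq_max//.
by rewrite ler_nat geq_max X0 leq_div.
Qed.

(* The sum over the outer variable [n] in the expanded square, for the pair of
   inner variables [(k, k - h)]. *)
Definition diag_sum theta X V k h : R :=
  `|\sum_(1 <= n < (X %/ k).+1)
      (if (V < n)%N then n%:R else 0) * tcos (n%:R * (h%:R * theta))|.

Lemma diag_sum_trivial theta X V k h : (0 < k)%N ->
  diag_sum theta X V k h <= (X%:R / k%:R) ^+ 2.
Proof.
move=> k0; have k0' : 0 < k%:R :> R by rewrite ltr0n.
have Xk : (X %/ k)%:R <= X%:R / k%:R :> R.
  by rewrite ler_pdivlMr// -natrM ler_nat leq_trunc_div.
apply: le_trans (ler_norm_sum _ _ _) _.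
apply: (@le_trans _ _ (\sum_(1 <= n < (X %/ k).+1) (X%:R / k%:R))).
  apply: ler_sum_nat => n /andP[_ nX]; rewrite normrM.
  rewrite -[leRHS]mulr1; apply: ler_pM => //; last exact: tcos_norm_le1.
  case: ifP => _; last by rewrite normr0 divr_ge0.
  by rewrite ger0_norm// (le_trans _ Xk)// ler_nat -ltnS.
rewrite big_const_nat iter_addr_0 subSS subn0 -[_ *+ (X %/ k)]mulr_natr expr2.
by rewrite ler_wpM2l// divr_ge0.
Qed.

Lemma diag_sum_far theta X V k h d : (0 < k)%N -> 0 < d -> far d (h%:R * theta) ->
  diag_sum theta X V k h <= X%:R / k%:R / d.
Proof.
move=> k0 d0 hd; have k0' : 0 < k%:R :> R by rewrite ltr0n.
pose g n : R := if (V < n)%N then n%:R else 0.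
apply: (@le_trans _ _ (d^-1 * g (X %/ k)%N)).
  apply: abel_le => // [i j ij|m].
    rewrite /g; case: ltnP => Vi; case: ltnP => Vj//; last by lia.
    by rewrite ler_nat.
  under eq_bigr => n _ do rewrite -[n%:R * _]addr0.
  exact: sum_tcos_le.
rewrite mulrC ler_wpM2r ?invr_ge0 ?(ltW d0)// /g.
case: ifP => _; last by rewrite divr_ge0.
by rewrite ler_pdivlMr// -natrM ler_nat leq_trunc_div.
Qed.

Lemma diag_sum_eq0 theta X V k h : (0 < k)%N -> (X < V * k)%N ->
  diag_sum theta X V k h = 0.
Proof.
move=> k0 XV; rewrite /diag_sum big_nat big1 ?normr0// => n /andP[_ nX].
rewrite ifF ?mul0r//; apply/negbTE; rewrite -leqNgt.
by rewrite (leq_trans _ (ltnW (_ : (X %/ k < V)%N)))// ltn_divLR.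
Qed.

(** Call [h] bad when [h theta] is within [d] of an integer. Two bad values at most [L] apart would
    put [(h' - h) theta] within [2 d] of an integer. Hence there are at most [k / L + 1] bad values,
    which get the trivial bound; the others get the geometric one. *)
Lemma sum_diag_sum_le theta X V k L d : (0 < k)%N -> (0 < L)%N -> 0 < d ->
  (forall h, (0 < h <= L)%N -> far (2 * d) (h%:R * theta)) ->
  \sum_(0 <= h < k) diag_sum theta X V k h <=
  (k%:R / L%:R + 1) * (X%:R / k%:R) ^+ 2 +
    (if (V * k <= X)%N then X%:R / d else 0).
Proof.
move=> k0 L0 d0 dL; have k0' : 0 < k%:R :> R by rewrite ltr0n.
have L0' : 0 < L%:R :> R by rewrite ltr0n.
have [VX|XV] := leqP (V * k) X; last first.
  rewrite big1 ?addr0; last by move=> h _; rewrite diag_sum_eq0.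
  by rewrite mulr_ge0 ?sqr_ge0// addr_ge0// divr_ge0.
pose bad h := ~~ `[< far d (h%:R * theta) >].
have badL h h' : bad h -> bad h' -> (h < h')%N -> (h + L < h')%N.
  move=> /asboolPn bh /asboolPn bh' hh'; rewrite ltnNge; apply/negP => h'L.
  move: bh => /existsNP[z /negP]; rewrite -ltNge => bz.
  move: bh' => /existsNP[z' /negP]; rewrite -ltNge => bz'.
  have := dL (h' - h)%N; rewrite subn_gt0 hh' leq_subLR h'L => /(_ isT (z' - z)).
  rewrite leNgt => /negP; apply; rewrite natrB ?(ltnW hh')// rmorphB /=.
  rewrite (_ : _ - _ = (h'%:R * theta - z'%:~R) - (h%:R * theta - z%:~R)); last by ring.
  by apply: le_lt_trans (ler_normB _ _) _; lra.
have pt h : diag_sum theta X V k h <=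
    (bad h)%:R * (X%:R / k%:R) ^+ 2 + X%:R / k%:R / d.
  have [fh|nfh] := boolP `[< far d (h%:R * theta) >]; rewrite /bad ?fh ?nfh /=.
    by rewrite mul0r add0r diag_sum_far//; apply/asboolP.
  by rewrite mul1r -[leLHS]addr0 lerD ?diag_sum_trivial// !divr_ge0// ltW.
apply: le_trans (ler_sum _ (fun h _ => pt h)) _.
rewrite big_split /= -mulr_suml; apply: lerD.
  rewrite ler_wpM2r ?sqr_ge0// -natr_sum.
  have := spaced_count_le bad L k L0 badL; rewrite -(ler_nat R) => /le_trans; apply.
  by rewrite -natr1 lerD2r ler_pdivlMr// -natrM ler_nat leq_trunc_div.
rewrite big_const_nat iter_addr_0 subn0 -[_ *+ k]mulr_natr.
by rewrite le_eqVlt; apply/orP; left; apply/eqP; field; rewrite !gt_eqF.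
Qed.

(** After expanding the square, pairs are folded onto [k2 <= k1] with [h = k1 - k2]. The diagonal is
    then counted twice, which is harmless for an upper bound. *)
Lemma sum_wave_sqr_le theta phi X V (b : nat -> R) :
  (forall k, (0 < k <= X)%N -> 0 <= b k) ->
  \sum_(1 <= n < X.+1) (if (V < n)%N then n%:R else 0) *
    (\sum_(1 <= k < X.+1) b k * wave theta phi X (n * k)) ^+ 2 <=
  2 * \sum_(1 <= k < X.+1) b k * \sum_(0 <= h < k)
     b (k - h)%N * diag_sum theta X V k h.
Proof.
move=> b0.
pose c n k := if (n * k <= X)%N then b k else 0.
pose x n k := (n * k)%:R * theta + phi.
pose D k1 k2 := diag_sum theta X V (maxn k1 k2) (maxn k1 k2 - minn k1 k2).
(* Adding the square of the corresponding sine sum leaves only differences of phases, so [phi]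
   disappears. *)
have sq n : (\sum_(1 <= k < X.+1) b k * wave theta phi X (n * k)) ^+ 2 <=
    \sum_(1 <= k1 < X.+1) \sum_(1 <= k2 < X.+1)
      c n k1 * c n k2 * tcos (x n k1 - x n k2).
  have -> : \sum_(1 <= k < X.+1) b k * wave theta phi X (n * k) =
      \sum_(1 <= k < X.+1) c n k * tcos (x n k).
    by apply: eq_bigr => k _; rewrite /c /wave; case: ifP; rewrite ?mulr0 ?mul0r.
  under [X in _ <= X]eq_bigr do under eq_bigr do rewrite tcosB mulrDr !mulrA.
  under [X in _ <= X]eq_bigr do rewrite big_split.
  rewrite big_split /=.
  have sqE (f : R -> R) : \sum_(1 <= k1 < X.+1) \sum_(1 <= k2 < X.+1)
      c n k1 * c n k2 * f (x n k1) * f (x n k2) =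
      (\sum_(1 <= k < X.+1) c n k * f (x n k)) ^+ 2.
    rewrite expr2 mulr_suml; apply: eq_bigr => k1 _; rewrite mulr_sumr.
    by apply: eq_bigr => k2 _; ring.
  by rewrite !sqE lerDl sqr_ge0.
have E k1 k2 : (0 < k1)%N -> (0 < k2)%N -> (k1 <= X)%N -> (k2 <= X)%N ->
   \sum_(1 <= n < X.+1) (if (V < n)%N then n%:R else 0) *
      (c n k1 * c n k2 * tcos (x n k1 - x n k2)) <= b k1 * b k2 * D k1 k2.
  move=> k10 k20 k1X k2X.
  have cE n : (0 < n)%N -> (if (V < n)%N then n%:R else 0) *
      (c n k1 * c n k2 * tcos (x n k1 - x n k2)) =
      b k1 * b k2 * (if (maxn k1 k2 * n <= X)%N then
      (if (V < n)%N then n%:R else 0) *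
        tcos (n%:R * ((maxn k1 k2 - minn k1 k2)%:R * theta)) else 0).
    move=> n0; rewrite /c maxnMl geq_max ![(_ * n)%N]mulnC.
    case: (n * k1 <= X)%N => /=; last by rewrite !(mulr0, mul0r).
    case: (n * k2 <= X)%N => /=; last by rewrite !(mulr0, mul0r).
    rewrite (_ : tcos (x n k1 - x n k2) =
      tcos (n%:R * ((maxn k1 k2 - minn k1 k2)%:R * theta))); first by ring.
    rewrite /x !natrM; case: (leqP k1 k2) => k12.
      rewrite natrB// -tcosN; congr tcos; ring.
    have k21 := ltnW k12.
    by rewrite natrB//; congr tcos; ring.
  under eq_big_nat => n /andP[n0 _] do rewrite cE//.
  rewrite -mulr_sumr ler_wpM2l ?mulr_ge0 ?b0 ?k10 ?k20//.
  rewrite (sum_cut X (maxn k1 k2) (fun n => (if (V < n)%N then n%:R else 0) *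
    tcos (n%:R * ((maxn k1 k2 - minn k1 k2)%:R * theta)))) ?leq_max ?k10//.
  exact: ler_norm.
apply: (@le_trans _ _ (\sum_(1 <= k1 < X.+1) \sum_(1 <= k2 < X.+1)
   b k1 * b k2 * D k1 k2)).
  apply: (@le_trans _ _ (\sum_(1 <= n < X.+1) \sum_(1 <= k1 < X.+1)
    \sum_(1 <= k2 < X.+1) (if (V < n)%N then n%:R else 0) *
      (c n k1 * c n k2 * tcos (x n k1 - x n k2)))).
    apply: ler_sum => n _.
    under [X in _ <= X]eq_bigr do rewrite -mulr_sumr.
    by rewrite -mulr_sumr ler_wpM2l//; case: ifP.
  rewrite exchange_big /=; apply: ler_sum_nat => k1 /andP[k10 k1X].
  rewrite exchange_big /=; apply: ler_sum_nat => k2 /andP[k20 k2X].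
  exact: E.
pose G k1 k2 := if (k2 <= k1)%N then b k1 * b k2 * D k1 k2 else 0.
apply: (@le_trans _ _ (\sum_(1 <= k1 < X.+1) \sum_(1 <= k2 < X.+1)
   (G k1 k2 + G k2 k1))).
  apply: ler_sum_nat => k1 /andP[k10 k1X]; apply: ler_sum_nat => k2 /andP[k20 k2X].
  rewrite /G [b k2 * _]mulrC [D k2 k1](_ : _ = D k1 k2); last first.
    by rewrite /D maxnC minnC.
  have H : 0 <= b k1 * b k2 * D k1 k2.
    by rewrite !mulr_ge0 ?normr_ge0// b0// ?k10 ?k20.
  by case: leqP => [_|/ltnW ->]; rewrite ?lerDl ?add0r//; case: ifP.
under eq_bigr do rewrite big_split.
rewrite big_split /= [X in _ + X]exchange_big /= -mulr2n -[_ *+ 2]mulr_natl.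
rewrite ler_wpM2l//; apply: ler_sum_nat => k /andP[k0 kX].
rewrite mulr_sumr [X in _ <= X]big_nat_rev /= add0n /G -big_mkcond /=.
rewrite (eq_bigl (fun k2 => true && (k2 < k.+1)%N)); last by move=> k2; rewrite ltnS.
rewrite -big_nat_widen// big_add1 /=.
rewrite le_eqVlt; apply/orP; left; apply/eqP; apply: eq_big_nat => j /andP[_ jk].
by rewrite /D (maxn_idPl jk) (minn_idPr jk) subKn// mulrA.
Qed.

(** Only the size and support of the coefficients matter. The three terms in the last factor come
    from the bad [h] ([k / L] of them, summed over [k]), from the extra 1 in that count ([k > U]),
    and from the geometric bounds ([V k <= X]). The parameter [t] balances the two sides of
    Cauchy-Schwarz. *)
Lemma typeII_le theta phi X U V L d l t (a b : nat -> R) :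
  (0 < X)%N -> (0 < U)%N -> (0 < V)%N -> (0 < L)%N -> 0 < d -> 0 < t ->
  (forall h, (0 < h <= L)%N -> far (2 * d) (h%:R * theta)) ->
  1 + ln X%:R <= l ->
  (forall n, `|a n| <= 1) ->
  (forall k, (0 < k <= X)%N -> 0 <= b k <= ln k%:R) ->
  (forall k, (0 < k <= U)%N -> b k = 0) ->
  `|\sum_(1 <= n < X.+1) (if (V < n)%N then a n else 0) *
      \sum_(1 <= k < X.+1) b k * wave theta phi X (n * k)| <=
  t * l + l ^+ 2 * X%:R ^+ 2 * (l / L%:R + U%:R^-1 + (V%:R * d)^-1) / t.
Proof.
move=> X0 U0 V0 L0 d0 t0 dL lX a1 bln bU.
have L0' : 0 < L%:R :> R by rewrite ltr0n.
have V0' : 0 < V%:R :> R by rewrite ltr0n.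
have lnX : 0 <= ln X%:R :> R by rewrite ln_ge0// ler1n.
have l0 : 0 <= l by lra.
have b0 k : (0 < k <= X)%N -> 0 <= b k by move=> /bln /andP[].
have bl k : (0 < k <= X)%N -> b k <= l.
  move=> /[dup] kX /bln /andP[_ /le_trans]; apply; case/andP: kX => k0 kX.
  have : ln k%:R <= ln X%:R :> R by rewrite ler_ln ?posrE ?ltr0n// ler_nat.
  by lra.
pose B n := \sum_(1 <= k < X.+1) b k * wave theta phi X (n * k).
pose Q := \sum_(1 <= n < X.+1) (if (V < n)%N then n%:R else 0) * (B n) ^+ 2.
have HX := le_trans (sum_inv_le X X0) lX.
(* AM-GM with weights [t / n] and [n / t]; the weight [n] on the square avoids a
   dyadic decomposition of the range of [n]. *)
have step1 : 2 * `|\sum_(1 <= n < X.+1) (if (V < n)%N then a n else 0) * B n|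
    <= t * l + Q / t.
  apply: (@le_trans _ _ (2 * \sum_(1 <= n < X.+1)
      `|(if (V < n)%N then a n else 0) * B n|)).
    by rewrite ler_pM2l// ler_norm_sum.
  apply: (@le_trans _ _ (t * \sum_(1 <= n < X.+1) n%:R^-1 + Q / t)); last first.
    by rewrite lerD2r ler_pM2l.
  rewrite /Q mulr_suml !mulr_sumr -big_split /=.
  apply: ler_sum_nat => n /andP[n0 _]; have n0' : 0 < n%:R :> R by rewrite ltr0n.
  case: ifP => _; last first.
    by rewrite !mul0r normr0 mulr0 addr0 divr_ge0 ?ltW.
  apply: (@le_trans _ _ (2 * `|B n|)).
    by rewrite ler_pM2l// normrM ler_piMl.
  rewrite -subr_ge0 -[B n ^+ 2]real_normK ?num_real//.
  rewrite (_ : _ - _ = n%:R / t * (t / n%:R - `|B n|) ^+ 2).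
    by rewrite mulr_ge0 ?sqr_ge0// divr_ge0// ltW.
  by field; rewrite !gt_eqF.
have step2 : Q <= 2 * (l ^+ 2 * X%:R ^+ 2 * (l / L%:R + U%:R^-1 + (V%:R * d)^-1)).
  apply: le_trans (sum_wave_sqr_le _ _ _ _ _ b0) _; rewrite ler_pM2l//.
  apply: (@le_trans _ _ (l ^+ 2 * \sum_(1 <= k < X.+1) (if (U < k)%N then
     \sum_(0 <= h < k) diag_sum theta X V k h else 0))).
    rewrite mulr_sumr; apply: ler_sum_nat => k /andP[k0 kX].
    case: ltnP => kU; last by rewrite bU ?k0// mul0r mulr0.
    rewrite !mulr_sumr; apply: ler_sum_nat => h /andP[_ hk].
    rewrite mulrA ler_wpM2r ?normr_ge0// expr2.
    have hX : (0 < k - h <= X)%N by rewrite subn_gt0 hk (leq_trans (leq_subr _ _)).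
    have kX' : (0 < k <= X)%N by rewrite k0.
    by apply: ler_pM; rewrite ?b0// bl.
  rewrite -mulrA ler_wpM2l ?sqr_ge0//.
  apply: (@le_trans _ _ (\sum_(1 <= k < X.+1)
     (X%:R ^+ 2 / L%:R * k%:R^-1 +
      (X%:R ^+ 2 * (if (U < k)%N then k%:R^-1 ^+ 2 else 0) +
      (if (V * k <= X)%N then X%:R / d else 0))))).
    apply: ler_sum_nat => k /andP[k0 kX]; have k0' : 0 < k%:R :> R by rewrite ltr0n.
    have T0 : 0 <= (if (V * k <= X)%N then X%:R / d else 0).
      by case: ifP => // _; rewrite divr_ge0// ltW.
    case: ifP => _; last first.
      by rewrite mulr0 add0r addr_ge0// mulr_ge0 ?invr_ge0// divr_ge0 ?sqr_ge0.
    apply: le_trans (sum_diag_sum_le theta X V k L d k0 L0 d0 dL) _.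
    rewrite addrA lerD2r le_eqVlt; apply/orP; left; apply/eqP.
    by field; rewrite !gt_eqF.
  rewrite !big_split /= -!mulr_sumr sum_cut// mulrDr mulrDr -addrA.
  apply: lerD.
    by rewrite mulrA mulrAC ler_wpM2r ?invr_ge0// ler_wpM2l ?sqr_ge0.
  apply: lerD.
    by rewrite ler_wpM2l ?sqr_ge0// sum_inv_sqr_le.
  rewrite big_const_nat iter_addr_0 subSS subn0 -[_ *+ (X %/ V)]mulr_natr.
  have XV : (X %/ V)%:R <= X%:R / V%:R :> R.
    by rewrite ler_pdivlMr// -natrM ler_nat leq_trunc_div.
  apply: le_trans (ler_wpM2l _ XV) _; first by rewrite divr_ge0// ltW.
  rewrite le_eqVlt; apply/orP; left; apply/eqP.
  by field; rewrite !gt_eqF.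
set S := `|_| in step1 *; set T := l ^+ 2 * _ * _ in step2 *.
rewrite -(ler_pM2l (_ : 0 < 2))//; apply: le_trans step1 _.
rewrite mulrDr; apply: lerD; last by rewrite mulrA ler_pM2r ?invr_gt0.
by rewrite ler_peMl ?ler1n// mulr_ge0// ltW.
Qed.

(** Vaughan's identity: [n <= U] is bounded trivially, a Moebius variable at most [V] gives type I
    sums, and a larger one gives a type II sum. The type I multipliers are [n] and [n m] with
    [n <= V] and [m <= U], hence the range [U * V] for [d1]. *)
Lemma sum_mangoldt_wave_le theta phi X U V L d1 d l t :
  (0 < X)%N -> (0 < U)%N -> (0 < V)%N -> (0 < L)%N -> 0 < d1 -> 0 < d -> 0 < t ->
  (forall n, (0 < n <= U * V)%N -> far d1 (n%:R * theta)) ->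
  (forall h, (0 < h <= L)%N -> far (2 * d) (h%:R * theta)) ->
  1 + ln X%:R <= l ->
  `|\sum_(1 <= n < X.+1) mangoldt n * tcos (n%:R * theta + phi)| <=
  U%:R * l + V%:R * (l / d1 + U%:R * l / d1) +
  (t * l + l ^+ 2 * X%:R ^+ 2 * (l / L%:R + U%:R^-1 + (V%:R * d)^-1) / t).
Proof.
move=> X0 U0 V0 L0 d10 d0 t0 dUV dL lX.
have lnX : 0 <= ln X%:R :> R by rewrite ln_ge0// ler1n.
have l0 : 0 <= l by lra.
have d1l : 0 <= l / d1 by rewrite divr_ge0// ltW.
pose F := wave theta phi X.
have F0 n : (X < n)%N -> F n = 0 by exact: wave_eq0.
pose b := @mangoldt_tail R X U.
have small_sum W (f : nat -> R) (c : R) : 0 <= c ->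
    (forall n, (0 < n <= X)%N -> (n <= W)%N -> `|f n| <= c) ->
    `|\sum_(1 <= n < X.+1) (if (n <= W)%N then f n else 0)| <= W%:R * c.
  move=> c0 fc; rewrite -big_mkcond /=.
  apply: le_trans (ler_norm_sum _ _ _) _.
  apply: (@le_trans _ _ (\sum_(1 <= n < X.+1 | (n <= W)%N) c)).
    rewrite big_nat_cond [leRHS]big_nat_cond; apply: ler_sum => n.
    by move=> /andP[/andP[n0 nX] nW]; apply: fc => //; rewrite n0.
  apply: (@le_trans _ _ (\sum_(1 <= n < W.+1) c)); last first.
    by rewrite big_const_nat iter_addr_0 subSS subn0 mulr_natl.
  rewrite big_mkcond /=; have [XW|WX] := leqP X W.
    rewrite [leRHS](big_cat_nat (n := X.+1))//= -[leLHS]addr0.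
    apply: lerD; last exact: sumr_ge0.
    by apply: ler_sum => n _; case: ifP.
  rewrite (big_cat_nat (n := W.+1))//=; last by rewrite ltnS ltnW.
  rewrite [X in _ + X]big_nat_cond [X in _ + X]big1 ?addr0.
    by apply: ler_sum => n _; case: ifP.
  by move=> n /andP[/andP[Wn _] _]; rewrite leqNgt Wn.
have mangoldt_l n : (0 < n <= X)%N -> `|@mangoldt R n| <= l.
  move=> /andP[n0 nX]; rewrite ger0_norm ?mangoldt_ge0//.
  apply: le_trans (mangoldt_le _ n0) _.
  have : ln n%:R <= ln X%:R :> R by rewrite ler_ln ?posrE ?ltr0n// ler_nat.
  by lra.
have -> : \sum_(1 <= n < X.+1) mangoldt n * tcos (n%:R * theta + phi) =
  \sum_(1 <= n < X.+1) (if (n <= U)%N then mangoldt n * F n else 0) +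
  (\sum_(1 <= n < X.+1) (if (n <= V)%N then
     mobius n * \sum_(1 <= k < X.+1) b k * F (n * k)%N else 0) +
  \sum_(1 <= n < X.+1) (if (V < n)%N then mobius n else 0) *
     \sum_(1 <= k < X.+1) b k * F (n * k)%N).
  rewrite -[X in _ + X]big_split /=.
  rewrite [X in _ + X](eq_bigr (fun n => mobius n *
     \sum_(1 <= k < X.+1) b k * F (n * k)%N)); last first.
    by move=> n _; case: leqP => _; rewrite ?mul0r ?addr0 ?add0r.
  rewrite -(sum_mangoldt_tail X U F)// -big_split /=.
  apply: eq_big_nat => n /andP[_]; rewrite ltnS => nX; rewrite /F /wave nX.
  by case: leqP => _; rewrite ?mul0r ?addr0 ?add0r.
apply: le_trans (ler_normD _ _) _; rewrite -[leRHS]addrA; apply: lerD.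
  apply: (small_sum U) => // n nX _; rewrite normrM -[l]mulr1.
  apply: ler_pM => //; first exact: mangoldt_l.
  by rewrite /F /wave; case: ifP => _; rewrite ?normr0 ?tcos_norm_le1.
apply: le_trans (ler_normD _ _) _; apply: lerD; last first.
  apply: (typeII_le _ _ _ U) => //; first exact: mobius_norm_le1.
    by move=> k kX; rewrite mangoldt_tail_ge0 mangoldt_tail_le.
  by move=> k kU; exact: mangoldt_tail_eq0.
apply: (small_sum V) => [|n /andP[n0 nX] nV].
  by rewrite addr_ge0// -mulrA mulr_ge0.
rewrite normrM -[leRHS]mul1r; apply: ler_pM => //; first exact: mobius_norm_le1.
rewrite sum_mangoldt_tail_typeI//.
apply: le_trans (ler_normB _ _) _; apply: lerD.
  apply: le_trans (sum_ln_wave_le _ _ _ _ d1 n0 X0 d10 _) _.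
    by apply: dUV; rewrite n0/= (leq_trans nV)// leq_pmull.
  by rewrite ler_wpM2r ?invr_ge0 ?(ltW d10)//; lra.
under eq_bigr => m _.
  rewrite (_ : _ * _ = if (m <= U)%N then
    mangoldt m * \sum_(1 <= k < X.+1) F (n * m * k)%N else 0); last first.
    by case: ifP; rewrite ?mul0r.
  over.
rewrite -mulrA; apply: (small_sum U) => // m /andP[m0 mX] mU.
rewrite normrM; apply: ler_pM => //; first by rewrite mangoldt_l// m0.
apply: sum_wave_le => //; first by rewrite muln_gt0 n0.
by apply: dUV; rewrite muln_gt0 n0 m0 mulnC leq_mul.
Qed.

End ExponentialSum.

(** * From arithmetic progressions to twisted sums over all integers *)

Section Progression.
Context {R : realType}.

(* Additive characters mod [q] detect the residue class of [a]. *)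
Lemma sum_mangoldt_progression_le (g phi B : R) (q a M : nat) : (a < q)%N ->
  (forall (b : nat) (psi : R), (b < q)%N ->
    `|\sum_(1 <= n < (q * M + a).+1)
        mangoldt n * tcos (n%:R * ((g + b%:R) / q%:R) + psi)| <= B) ->
  `|\sum_(0 <= m < M.+1) mangoldt (q * m + a) * tcos (m%:R * g + phi)| <= B.
Proof.
move=> aq HB; set X := (q * M + a)%N in HB.
have q0 : (0 < q)%N by apply: leq_ltn_trans aq.
have q0' : 0 < q%:R :> R by rewrite ltr0n.
(* This phase removes the contribution of [a]: at [n = q m + a] the argument is [m g + phi] plus the
   integer [m b]. *)
pose psi b := phi - a%:R * ((g + b%:R) / q%:R).
set S := \sum_(0 <= m < M.+1) _.
have SE : q%:R * S = \sum_(0 <= b < q) \sum_(1 <= n < X.+1)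
    mangoldt n * tcos (n%:R * ((g + b%:R) / q%:R) + psi b).
  rewrite exchange_big /=.
  transitivity (\sum_(0 <= n < X.+1) if (n %% q == a)%N then
     q%:R * (mangoldt n * tcos ((n %/ q)%:R * g + phi)) else 0); last first.
    have L0 : mangoldt 0 = 0 :> R by [].
    rewrite [LHS]big_nat_recl// L0 mul0r mulr0 if_same add0r.
    rewrite [RHS]big_add1 /=; apply: eq_bigr => n _; set m := n.+1.
    rewrite -mulr_sumr.
    pose z : int := m%:Z - a%:Z.
    have tE b : tcos (m%:R * ((g + b%:R) / q%:R) + psi b) =
        tcos (b%:R * (z%:~R / q%:R) + (z%:~R * g / q%:R + phi)) :> R.
      congr tcos; rewrite /psi /z rmorphB /= !pmulrn; field.
      by rewrite gt_eqF.
    rewrite [in RHS](eq_bigr _ (fun b _ => tE b)).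
    case: eqP => ma; last first.
      rewrite sum_tcos0 ?mulr0// /z -eqz_mod_dvd !modz_nat.
      by rewrite (modn_small aq); apply/eqP => -[].
    have zE : z = (m %/ q)%:Z * q by rewrite /z {1}(divn_eq m q) ma; lia.
    rewrite (eq_bigr (fun=> tcos ((m %/ q)%:R * g + phi))); last first.
      move=> b _; rewrite zE rmorphM /= -[RHS](tcosDn _ (b * (m %/ q))).
      by congr tcos; rewrite natrM -!pmulrn; field; rewrite gt_eqF.
    rewrite mulrCA big_const_nat iter_addr_0 subn0; congr (_ * _).
    exact: mulr_natl.
  rewrite /S mulr_sumr.
  transitivity (\sum_(0 <= m < M.+1) \sum_(0 <= n < X.+1)
     if (n == q * m + a)%N then
       q%:R * (mangoldt n * tcos ((n %/ q)%:R * g + phi)) else 0).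
    apply: eq_big_nat => m /andP[_ mM]; rewrite -big_mkcond big_nat1_eq ifT.
      by rewrite mulnC divnMDl// divn_small// addn0 mulnC.
    by rewrite /= ltnS leq_add2r leq_mul2l orbC -ltnS mM.
  rewrite exchange_big /=; apply: eq_big_nat => n /andP[_ nX].
  case: eqP => na.
    rewrite (eq_bigr (fun m => if (m == n %/ q)%N then
       q%:R * (mangoldt n * tcos ((n %/ q)%:R * g + phi)) else 0)); last first.
      move=> m _; congr (if _ then _ else _).
      by rewrite {1}(divn_eq n q) na eqn_add2r mulnC eqn_pmul2l// eq_sym.
    rewrite -big_mkcond big_nat1_eq ifT//= ltnS -ltnS.
    rewrite ltn_divLR// (leq_ltn_trans (n := X))//.
    by rewrite /X mulSn mulnC addnC ltn_add2r.
  rewrite big1// => m _; case: eqP => // nE; case: na.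
  by rewrite nE mulnC modnMDl modn_small.
rewrite -(ler_pM2l q0') -[X in X * `|_|]gtr0_norm// -normrM SE.
apply: le_trans (ler_norm_sum _ _ _) _.
apply: (@le_trans _ _ (\sum_(0 <= b < q) B)).
  by apply: ler_sum_nat => b /andP[_ bq]; exact: HB.
by rewrite big_const_nat iter_addr_0 subn0 mulr_natl.
Qed.

End Progression.

(** * Approximation of the fractional part *)

Section Fejer.
Context {R : realType}.
Implicit Types (x y d : R) (K J i j : nat).

(** The Fejer kernel: the squared modulus of a sum of [K] consecutive exponentials, divided by [K]
    and written out as a double sum of frequencies. *)
Definition fejer K x : R :=
  K%:R^-1 * \sum_(0 <= i < K) \sum_(0 <= j < K) tcos ((i%:R - j%:R) * x).

Lemma fejerE K x : fejer K x = K%:R^-1 *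
  ((\sum_(0 <= i < K) tcos (i%:R * x)) ^+ 2 +
   (\sum_(0 <= i < K) tsin (i%:R * x)) ^+ 2).
Proof.
rewrite /fejer !expr2 !mulr_suml -big_split /=; congr (_ * _).
apply: eq_bigr => i _; rewrite !mulr_sumr -big_split /=.
by apply: eq_bigr => j _; rewrite mulrBl tcosB.
Qed.

Lemma fejer_ge0 K x : 0 <= fejer K x.
Proof. by rewrite fejerE mulr_ge0 ?invr_ge0// addr_ge0 ?sqr_ge0. Qed.

Lemma fejer_far K x d : (0 < K)%N -> 0 < d -> far d x ->
  fejer K x <= 2 / (K%:R * d ^+ 2).
Proof.
move=> K0 d0 xd; have K0' : 0 < K%:R :> R by rewrite ltr0n.
have H phi : (\sum_(0 <= i < K) tcos (i%:R * x + phi)) ^+ 2 <= d^-1 ^+ 2.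
  rewrite -real_normK ?num_real// ler_sqr ?nnegrE ?invr_ge0 ?(ltW d0)//.
  exact: sum_tcos_le.
have tsinE y : tsin y = tcos (y - 1 / 4).
  by rewrite /tsin -cosBpihalf /tcos; congr cos; field.
have := H 0; have := H (- (1 / 4)).
under eq_bigr do rewrite -tsinE.
under [X in _ -> X ^+ 2 <= _ -> _]eq_bigr do rewrite addr0.
rewrite fejerE => h1 h2; rewrite invfM mulrCA ler_pM2l ?invr_gt0//.
rewrite -exprVn; lra.
Qed.

(** A nonzero frequency [j - i] has absolute value below [K], so [K] does not divide it and it
    averages to 0; the [K] diagonal terms remain. *)
Lemma fejer_mean K x : (0 < K)%N ->
  K%:R^-1 * \sum_(0 <= l < K) fejer K (x - l%:R / K%:R) = 1.
Proof.
move=> K0; have K0' : K%:R != 0 :> R by rewrite pnatr_eq0 -lt0n.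
rewrite -mulr_sumr exchange_big /=.
under eq_bigr do rewrite exchange_big /=.
rewrite (eq_big_nat _ _ (F2 := fun=> K%:R)); last first.
  move=> i /andP[_ iK].
  rewrite (eq_big_nat _ _ (F2 := fun j => if j == i then K%:R else 0)); last first.
    move=> j /andP[_ jK]; case: eqP => [->|ji].
      under eq_bigr do rewrite subrr mul0r tcos0.
      by rewrite big_const_nat iter_addr_0 subn0.
    pose z : int := j%:Z - i%:Z.
    rewrite -[RHS](@sum_tcos0 R z K ((i%:R - j%:R) * x))//.
      apply: eq_bigr => l _; congr tcos; rewrite /z rmorphB /= !pmulrn.
      by field.
    apply/negP => /dvdzP[w wE]; rewrite /z in wE.
    have : w = 0 by nia.
    by move=> w0; apply: ji; rewrite w0 mul0r in wE; lia.
  by rewrite -big_mkcond big_nat1_eq iK.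
by rewrite big_const_nat iter_addr_0 subn0 -[_ *+ K]mulr_natr; field.
Qed.

(** All phases [i x] lie within an eighth of a turn of an integer, so every cosine exceeds [7 / 10],
    and [49 / 100 >= 2 / 5]. The kernel thus serves as a majorant for counting points close to
    integers. *)
Lemma fejer_near J x : (0 < J)%N -> ~ far (8 * J%:R)^-1 x ->
  2 / 5 * J%:R <= fejer J x.
Proof.
move=> J0 /existsNP[z /negP]; rewrite -ltNge => xz.
have J0' : 0 < J%:R :> R by rewrite ltr0n.
have pi0 : 0 < (pi : R) := pi_gt0 R.
set y := x - z%:~R in xz.
have C i : (i < J)%N -> 7 / 10 <= tcos (i%:R * x).
  move=> iJ.
  have -> : tcos (i%:R * x) = tcos (i%:R * y).
    rewrite -[RHS](tcosDz _ (i%:Z * z)); congr tcos.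
    by rewrite /y rmorphM /= pmulrn; ring.
  rewrite /tcos -cos_norm; set u := `|_|.
  have /andP[u0 u1] : 0 <= u <= pi / 4.
    rewrite normr_ge0 /= /u !normrM !normr_nat (ger0_norm (ltW pi0)).
    have : i%:R * `|y| <= 1 / 8.
      apply: (@le_trans _ _ (J%:R * (8 * J%:R)^-1)).
        by apply: ler_pM => //; [rewrite ler_nat ltnW | rewrite ltW].
      by rewrite invfM mulrCA mulfV ?gt_eqF//; lra.
    by set v := i%:R * _; nra.
  have c0 : 0 <= cos u by apply: cos_ge0_pihalf; apply/andP; split; lra.
  have : 1 / 2 <= cos u ^+ 2 by apply: cos_sqr_ge_half; rewrite u0.
  by nra.
have CS : 7 / 10 * J%:R <= \sum_(0 <= i < J) tcos (i%:R * x).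
  apply: (@le_trans _ _ (\sum_(0 <= i < J) (7 / 10))).
    by rewrite big_const_nat iter_addr_0 subn0 -[(7 / 10) *+ J]mulr_natr.
  by apply: ler_sum_nat => i /andP[_]; exact: C.
rewrite fejerE [leRHS]mulrC ler_pdivlMr//.
have := sqr_ge0 (\sum_(0 <= i < J) tsin (i%:R * x)).
by move: CS; set c := \sum_(0 <= i < J) _; set s := _ ^+ 2; nra.
Qed.

(* [fejer K] has degree less than [K], so averaging its translates over the [K]
   points [l / K] is exact (see [fejer_mean]) and no integral is needed. *)
Definition sawtooth K x : R :=
  K%:R^-1 * \sum_(0 <= l < K) l%:R / K%:R * fejer K (x - l%:R / K%:R).

Lemma fpart_itv x : 0 <= fpart x < 1.
Proof.
rewrite /fpart subr_ge0 floor_le /= ltrBlDl.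
by have := floorD1_gt x; rewrite rmorphD.
Qed.

Lemma fpart_sawtoothE K x : (0 < K)%N -> fpart x - sawtooth K x =
  K%:R^-1 * \sum_(0 <= l < K) (fpart x - l%:R / K%:R) * fejer K (x - l%:R / K%:R).
Proof.
move=> K0; have -> : fpart x - sawtooth K x = fpart x *
    (K%:R^-1 * \sum_(0 <= l < K) fejer K (x - l%:R / K%:R)) - sawtooth K x.
  by rewrite fejer_mean// mulr1.
rewrite mulrCA -mulrBr.
congr (_ * _); rewrite mulr_sumr -sumrB.
by apply: eq_bigr => l _; rewrite [in RHS]mulrBl.
Qed.

(** With [x] away from the integers there is no wrap-around: closeness modulo 1 is closeness of the
    fractional part itself. *)
Lemma fpart_near x y d : 0 < d -> 0 <= y < 1 -> far d x -> ~ far d (x - y) ->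
  `|fpart x - y| <= d.
Proof.
move=> d0 /andP[y0 y1] xd /existsNP[z /negP]; rewrite -ltNge ltr_norml => /andP[z1 z2].
have /andP[f0 f1] := fpart_itv x.
have e1 : d <= fpart x by have := xd (Num.floor x); rewrite -/(fpart x) ger0_norm.
have e2 : fpart x <= 1 - d.
  have := xd (Num.floor x + 1); rewrite rmorphD /= opprD addrA -/(fpart x).
  by rewrite ler0_norm; lra.
have zE : z = Num.floor x.
  have E : x = fpart x + (Num.floor x)%:~R by rewrite /fpart subrK.
  have H1 : (z - Num.floor x)%:~R < 1 :> R by rewrite rmorphB /=; lra.
  have H2 : - 1 < (z - Num.floor x)%:~R :> R by rewrite rmorphB /=; lra.
  have {}H1 : z - Num.floor x < 1 by rewrite -(ltr_int R).
  have {}H2 : - 1 < z - Num.floor x by rewrite -(ltr_int R).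
  lia.
by rewrite ler_norml /fpart -zE; apply/andP; split; lra.
Qed.

Lemma fpart_sawtooth_le1 K x : (0 < K)%N -> `|fpart x - sawtooth K x| <= 1.
Proof.
move=> K0; have K0' : 0 < K%:R :> R by rewrite ltr0n.
rewrite fpart_sawtoothE// normrM ger0_norm ?invr_ge0// -[leRHS](fejer_mean K x K0).
rewrite ler_pM2l ?invr_gt0//; apply: le_trans (ler_norm_sum _ _ _) _.
apply: ler_sum_nat => l /andP[_ lK]; rewrite normrM [`|fejer _ _|]ger0_norm ?fejer_ge0//.
rewrite ler_piMl ?fejer_ge0//; have := fpart_itv x.
have : l%:R / K%:R < 1 :> R by rewrite ltr_pdivrMr// mul1r ltr_nat.
have : 0 <= l%:R / K%:R :> R by rewrite divr_ge0.
by move=> ? ? /andP[? ?]; rewrite ler_norml; apply/andP; split; lra.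
Qed.

(** Translates [l / K] close to [x] modulo 1 cost [d] times a kernel of mean 1; at the others the
    kernel itself is small. *)
Lemma fpart_sawtooth_far K x d : (0 < K)%N -> 0 < d -> far d x ->
  `|fpart x - sawtooth K x| <= d + 2 / (K%:R * d ^+ 2).
Proof.
move=> K0 d0 xd; have K0' : 0 < K%:R :> R by rewrite ltr0n.
set e := 2 / _; have e0 : 0 <= e by rewrite divr_ge0// mulr_ge0 ?sqr_ge0.
rewrite fpart_sawtoothE// normrM ger0_norm ?invr_ge0//.
have -> : d + e = K%:R^-1 * \sum_(0 <= l < K) (d * fejer K (x - l%:R / K%:R) + e).
  rewrite big_split /= -mulr_sumr mulrDr mulrCA fejer_mean// mulr1.
  by rewrite big_const_nat iter_addr_0 subn0 -[e *+ K]mulr_natl mulKf ?gt_eqF.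
rewrite ler_pM2l ?invr_gt0//; apply: le_trans (ler_norm_sum _ _ _) _.
apply: ler_sum_nat => l /andP[_ lK]; rewrite normrM [`|fejer _ _|]ger0_norm ?fejer_ge0//.
have l1 : l%:R / K%:R < 1 :> R by rewrite ltr_pdivrMr// mul1r ltr_nat.
have l0 : 0 <= l%:R / K%:R :> R by rewrite divr_ge0.
have F0 := fejer_ge0 K (x - l%:R / K%:R).
have [nx|fx] := pselect (far d (x - l%:R / K%:R)); last first.
  rewrite -[leLHS]addr0 lerD// ler_wpM2r// fpart_near//.
  by apply/andP.
apply: (@le_trans _ _ (fejer K (x - l%:R / K%:R))).
  rewrite ler_piMl//; have /andP[? ?] := fpart_itv x.
  by rewrite ler_norml; apply/andP; split; lra.
apply: le_trans (fejer_far _ _ _ K0 d0 nx) _.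
by rewrite lerDr mulr_ge0// ltW.
Qed.

Section Equidistribution.
Context (w x : nat -> R) (M K : nat) (B : R).
Context (w0 : forall m, 0 <= w m) (K0 : (0 < K)%N).
Context (wB : forall h phi, (0 < h < K)%N ->
  `|\sum_(1 <= m < M.+1) w m * tcos (h%:R * x m + phi)| <= B).

Let W := \sum_(1 <= m < M.+1) w m.

(** The diagonal frequencies produce [W]. Each of the other at most [J ^ 2] costs [B], and the
    kernel divides by [J]. *)
Lemma sum_fejer_le J y : (0 < J <= K)%N -> 0 <= B ->
  `|\sum_(1 <= m < M.+1) w m * fejer J (x m - y) - W| <= J%:R * B.
Proof.
move=> /andP[J0 JK] B0; have J0' : 0 < J%:R :> R by rewrite ltr0n.
have -> : \sum_(1 <= m < M.+1) w m * fejer J (x m - y) - W = J%:R^-1 *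
   \sum_(0 <= i < J) \sum_(0 <= j < J)
     (\sum_(1 <= m < M.+1) w m * tcos ((i%:R - j%:R) * (x m - y)) -
      if j == i then W else 0).
  under [in RHS]eq_bigr do rewrite sumrB.
  rewrite sumrB mulrBr; congr (_ - _).
    rewrite [in RHS](eq_bigr (fun i => \sum_(1 <= m < M.+1) \sum_(0 <= j < J)
      w m * tcos ((i%:R - j%:R) * (x m - y)))); last by move=> i _; exact: exchange_big.
    rewrite [in RHS]exchange_big /= mulr_sumr; apply: eq_bigr => m _.
    rewrite /fejer mulrCA; congr (_ * _); rewrite mulr_sumr; apply: eq_bigr => i _.
    exact: mulr_sumr.
  rewrite (eq_big_nat _ _ (F2 := fun=> W)); last first.
    by move=> i /andP[_ iJ]; rewrite -big_mkcond big_nat1_eq iJ.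
  by rewrite big_const_nat iter_addr_0 subn0 -[W *+ J]mulr_natl mulKf ?gt_eqF.
rewrite normrM ger0_norm ?invr_ge0// mulrC ler_pdivrMr//.
apply: le_trans (ler_norm_sum _ _ _) _.
have -> : J%:R * B * J%:R = \sum_(0 <= i < J) \sum_(0 <= j < J) B.
  rewrite !big_const_nat !iter_addr_0 !subn0.
  by rewrite -[(B *+ J) *+ J]mulr_natr -[B *+ J]mulr_natr [J%:R * B]mulrC.
apply: ler_sum_nat => i /andP[_ iJ]; apply: le_trans (ler_norm_sum _ _ _) _.
apply: ler_sum_nat => j /andP[_ jJ].
case: (ltngtP j i) => ji.
- rewrite subr0; have := wB (i - j) (- ((i - j)%:R * y)).
  rewrite subn_gt0 ji (leq_ltn_trans (leq_subr _ _) (leq_trans iJ JK)) => /(_ isT).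
  congr (`|_| <= _); apply: eq_bigr => m _; congr (_ * tcos _).
  by rewrite natrB ?(ltnW ji)//; ring.
- rewrite subr0; have := wB (j - i) (- ((j - i)%:R * y)).
  rewrite subn_gt0 ji (leq_ltn_trans (leq_subr _ _) (leq_trans jJ JK)) => /(_ isT).
  congr (`|_| <= _); apply: eq_bigr => m _; rewrite -[in RHS]tcosN.
  by congr (_ * tcos _); rewrite natrB ?(ltnW ji)//; ring.
- rewrite ji (eq_bigr w) ?subrr ?normr0// => m _.
  by rewrite mul0r tcos0 mulr1.
Qed.

(** Two kernels are used. The one of degree [K] approximates the fractional part with error
    [d + 128 J ^ 2 / K] at points at least [d = 1 / (8 J)] from the integers. At the remaining
    points the error is at most 1, which [5 / (2 J)] times the kernel of degree [J] dominates. *)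
Lemma sum_fpart_le J : (0 < J <= K)%N -> 0 <= B ->
  `|\sum_(1 <= m < M.+1) w m * fpart (x m) -
     W * (K%:R^-1 * \sum_(0 <= l < K) l%:R / K%:R)| <=
  (K%:R + 3) * B + W * ((8 * J%:R)^-1 + 128 * J%:R ^+ 2 / K%:R + 5 / (2 * J%:R)).
Proof.
move=> /[dup] JK /andP[J0 _] B0; have J0' : 0 < J%:R :> R by rewrite ltr0n.
have K0' : 0 < K%:R :> R by rewrite ltr0n.
have W0 : 0 <= W by apply: sumr_ge0.
set d := (8 * J%:R)^-1; have d0 : 0 < d by rewrite invr_gt0 mulr_gt0.
have e2 : 2 / (K%:R * d ^+ 2) = 128 * J%:R ^+ 2 / K%:R.
  by rewrite /d; field; rewrite !gt_eqF.
set e := 128 * _ / _; have e0 : 0 <= e by rewrite divr_ge0// mulr_ge0 ?sqr_ge0.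
have saw : `|\sum_(1 <= m < M.+1) w m * sawtooth K (x m) -
     W * (K%:R^-1 * \sum_(0 <= l < K) l%:R / K%:R)| <= K%:R * B.
  have -> : \sum_(1 <= m < M.+1) w m * sawtooth K (x m) -
     W * (K%:R^-1 * \sum_(0 <= l < K) l%:R / K%:R) = K%:R^-1 *
     \sum_(0 <= l < K) l%:R / K%:R *
       (\sum_(1 <= m < M.+1) w m * fejer K (x m - l%:R / K%:R) - W).
    under [in RHS]eq_bigr do rewrite mulrBr.
    rewrite sumrB mulrBr; congr (_ - _); last first.
      rewrite mulrCA; congr (_ * _); rewrite mulr_sumr.
      by apply: eq_bigr => l _; exact: mulrC.
    under [in RHS]eq_bigr do rewrite mulr_sumr.
    rewrite exchange_big /= mulr_sumr; apply: eq_bigr => m _.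
    rewrite /sawtooth mulrCA; congr (_ * _); rewrite mulr_sumr.
    by apply: eq_bigr => l _; exact: mulrCA.
  rewrite normrM ger0_norm ?invr_ge0// mulrC ler_pdivrMr//.
  apply: le_trans (ler_norm_sum _ _ _) _.
  apply: (@le_trans _ _ (\sum_(0 <= l < K) K%:R * B)); last first.
    by rewrite big_const_nat iter_addr_0 subn0 -[(_ * B) *+ K]mulr_natr.
  apply: ler_sum_nat => l /andP[_ lK]; rewrite normrM -[leRHS]mul1r.
  apply: ler_pM => //; last by apply: sum_fejer_le; rewrite ?K0 ?leqnn.
  by rewrite ger0_norm ?divr_ge0// ler_pdivrMr// mul1r ler_nat ltnW.
have diff : `|\sum_(1 <= m < M.+1) w m * fpart (x m) -
    \sum_(1 <= m < M.+1) w m * sawtooth K (x m)| <=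
    W * (d + e) + 5 / (2 * J%:R) * (W + J%:R * B).
  apply: (@le_trans _ _ (\sum_(1 <= m < M.+1)
     (w m * (d + e) + 5 / (2 * J%:R) * (w m * fejer J (x m - 0))))).
    rewrite -sumrB; apply: le_trans (ler_norm_sum _ _ _) _; apply: ler_sum => m _.
    rewrite -mulrBr normrM ger0_norm// subr0 [X in _ <= _ + X]mulrCA -mulrDr.
    rewrite ler_wpM2l//; have F0 := fejer_ge0 J (x m).
    have [fx|nx] := pselect (far d (x m)).
      rewrite -[leLHS]addr0 lerD//; last first.
        by apply: mulr_ge0 => //; rewrite divr_ge0// mulr_ge0.
      by apply: le_trans (fpart_sawtooth_far _ _ _ K0 d0 fx) _; rewrite e2.
    apply: le_trans (fpart_sawtooth_le1 K (x m) K0) _.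
    have := fejer_near J (x m) J0 nx => near.
    apply: (@le_trans _ _ (5 / (2 * J%:R) * (2 / 5 * J%:R))).
      by rewrite le_eqVlt; apply/orP; left; apply/eqP; field; rewrite gt_eqF.
    rewrite -[leLHS]add0r lerD ?addr_ge0 ?(ltW d0)// ler_wpM2l//.
  rewrite big_split /= -mulr_suml -mulr_sumr lerD2l ler_wpM2l ?divr_ge0 ?mulr_ge0//.
  by have := sum_fejer_le J 0 JK B0; rewrite ler_norml -/W => /andP[_]; lra.
rewrite -[X in `|X - _|](subrK (\sum_(1 <= m < M.+1) w m * sawtooth K (x m))) -addrA.
apply: le_trans (ler_normD _ _) _; apply: le_trans (lerD diff saw) _.
rewrite (_ : 5 / (2 * J%:R) * (W + J%:R * B) = W * (5 / (2 * J%:R)) + 5 / 2 * B).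
  rewrite [(_ + 3) * B]mulrDl [W * (_ + 5 / _)]mulrDr.
  by move: (W * (d + e)) (W * (_ / _)) (K%:R * B) => u v b; lra.
by field; rewrite gt_eqF.
Qed.

End Equidistribution.
End Fejer.

(** * Diophantine approximation *)

Section Diophantine.
Context {R : realType}.
Implicit Types (alpha x d c : R) (n m t : nat).

Lemma dist_int_ge0 x : 0 <= dist_int x.
Proof.
apply: lb_le_inf; first by exists `|x - 0%:~R|; exists 0.
by move=> _ [m _ <-].
Qed.

Lemma dist_int_far x : far (dist_int x) x.
Proof.
move=> z; apply: ge_inf; last by exists z.
by exists 0 => _ [m _ <-].
Qed.

Lemma far_irrational alpha n : irrational alpha -> (0 < n)%N ->
  exists2 d, 0 < d & far d (n%:R * alpha).
Proof.
move=> irr n0; have n0' : n%:R != 0 :> R by rewrite pnatr_eq0 -lt0n.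
set y := n%:R * alpha.
have fy : 0 < fpart y.
  have /andP[f0 _] := fpart_itv y; rewrite lt0r f0 andbT.
  apply/eqP => fy; apply: irr; exists ((Num.floor y)%:~R / n%:R) => //=.
  rewrite fmorph_div /= ratr_int ratr_nat; move: fy; rewrite /fpart => /eqP.
  by rewrite subr_eq0 => /eqP <-; rewrite /y mulrC mulKf.
have /andP[_ f1] := fpart_itv y.
exists (Num.min (fpart y) (1 - fpart y)); first by rewrite lt_min fy subr_gt0.
move=> z; rewrite ge_min.
have E : y = fpart y + (Num.floor y)%:~R by rewrite /fpart subrK.
have [zf|fz] := leP z (Num.floor y).
  have : z%:~R <= (Num.floor y)%:~R :> R by rewrite ler_int.
  by move=> H; rewrite (le_trans _ (ler_norm _))//; lra.
have : (Num.floor y + 1)%:~R <= z%:~R :> R by rewrite ler_int; lia.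
rewrite rmorphD /= => H; rewrite distrC; apply/orP; right.
by apply: le_trans (ler_norm _); lra.
Qed.

(** An integer [t] above the type lies outside the set defining it, so its lower limit is not 0. If
    no [c] worked for [t], every tail infimum would be 0, and so would the lower limit. *)
Lemma finite_type_eventually alpha : finite_type alpha ->
  exists t c N, 0 < c /\ forall n, (N <= n)%N ->
    c <= n%:R ^+ t * dist_int (alpha * n%:R).
Proof.
move=> ft.
have [t ht] : exists t : nat, (irr_type alpha < t%:R%:E)%E.
  move: ft; rewrite /finite_type; case: (irr_type alpha) => [r| |] // _.
    exists (Num.truncn r).+1; rewrite lte_fin.
    by have [r0|r0] := leP 0 r; [have /andP[] := truncn_itv r0 | apply: lt_le_trans r0 _].
  by exists 0%N; rewrite ltNye.
pose u n := n%:R ^+ t * dist_int (alpha * n%:R) : R.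
have u0 n : 0 <= u n by rewrite mulr_ge0 ?exprn_ge0 ?dist_int_ge0.
have uN0 : limn_einf (fun n => (u n)%:E) <> 0%E.
  move=> E; move: ht; apply/negP; rewrite -leNgt.
  apply: ereal_sup_ubound; exists t%:R => //=; rewrite -[RHS]E; congr limn_einf.
  by apply/funext => n; rewrite powR_mulrn.
apply: contrapT => H; apply: uN0.
suff E : einfs (fun n => (u n)%:E) = cst 0%E.
  by rewrite limn_einf_lim E lim_cst.
apply/funext => N; apply/eqP; rewrite eq_le; apply/andP; split; last first.
  by apply: le_ereal_inf_tmp => _ [n _ <-]; rewrite lee_fin.
apply/lee_addgt0Pr => e e0; rewrite add0e.
have [n Nn un] : exists2 n, (N <= n)%N & u n < e.
  apply: contrapT => K; apply: H; exists t, e, N; split=> // n Nn.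
  by rewrite leNgt; apply/negP => un; apply: K; exists n.
apply: (@le_trans _ _ (u n)%:E); last by rewrite lee_fin ltW.
by apply: ereal_inf_lbound; exists n.
Qed.

(** The finitely many [n] below the threshold are covered by irrationality, at the price of a
    smaller constant. *)
Lemma finite_type_far alpha : irrational alpha -> finite_type alpha ->
  exists t c, 0 < c /\ forall n, (0 < n)%N -> far (c / n%:R ^+ t) (n%:R * alpha).
Proof.
move=> irr /finite_type_eventually[t [c [N [c0 cN]]]].
have [d d0 dN] : exists2 d, 0 < d &
    forall n, (0 < n < N)%N -> far d (n%:R * alpha).
  elim: N {cN} => [|N [d d0 dN]]; first by exists 1 => // n; rewrite ltn0 andbF.
  have [N0|N0] := posnP N.
    by exists d => // n; rewrite N0 ltnS leqn0; case: n.
  have [e e0 eN] := far_irrational _ _ irr N0.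
  exists (Num.min d e); first by rewrite lt_min d0.
  move=> n /andP[n0]; rewrite ltnS leq_eqVlt => /orP[/eqP ->|nN].
    by apply: far_le eN; rewrite ge_min lexx orbT.
  by apply: far_le (dN n _); rewrite ?ge_min ?lexx// n0.
exists t, (Num.min c d); split; first by rewrite lt_min c0.
move=> n n0; have nt : 1 <= n%:R ^+ t :> R by rewrite exprn_ege1// ler1n.
have nt0 : 0 < n%:R ^+ t :> R by apply: lt_le_trans nt.
have [Nn|nN] := leqP N n.
  apply: far_le (dist_int_far _); rewrite ler_pdivrMr// ge_min mulrC [n%:R * _]mulrC.
  by rewrite cN.
apply: far_le (dN n _); last by rewrite n0.
rewrite ler_pdivrMr// ge_min; apply/orP; right.
by rewrite ler_peMr// ltW.
Qed.

(** The exponent [t] passes to the inverse because [n g - m = - g (m alpha - n)] and [m] is at most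
    a multiple of [n]. *)
Lemma far_inv alpha t c : 0 < alpha -> 0 < c ->
  (forall n, (0 < n)%N -> far (c / n%:R ^+ t) (n%:R * alpha)) ->
  exists2 e, 0 < e & forall n, (0 < n)%N -> far (e / n%:R ^+ t) (n%:R * alpha^-1).
Proof.
move=> a0 c0 cF; set g := alpha^-1; have g0 : 0 < g by rewrite invr_gt0.
have gt0 : 0 < (g + 1) ^+ t by rewrite exprn_gt0// addr_gt0.
(* The three bounds serve integers [z] at distance at least 1, integers [z <= 0], and the remaining
   [z], which satisfy [z <= (g + 1) n]. *)
pose e := Num.min (Num.min 1 g) (g * c / (g + 1) ^+ t).
have e0 : 0 < e by rewrite !lt_min ltr01 g0 divr_gt0// mulr_gt0.
have e1 : e <= 1 by rewrite !ge_min lexx.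
have eg : e <= g by rewrite !ge_min lexx orbT.
have ec : e <= g * c / (g + 1) ^+ t by rewrite ge_min lexx orbT.
exists e => // n n0 z; have n1 : 1 <= n%:R :> R by rewrite ler1n.
have nt : 1 <= n%:R ^+ t :> R by rewrite exprn_ege1.
have nt0 : 0 < n%:R ^+ t :> R by apply: lt_le_trans nt.
have en : e / n%:R ^+ t <= e by rewrite ler_pdivrMr// ler_peMr// ltW.
have [z0|z0] := leP z 0.
  apply: le_trans en _; apply: le_trans eg _; apply: le_trans (ler_norm _).
  have : z%:~R <= 0 :> R by rewrite (ler_int _ z 0).
  have : g <= n%:R * g by rewrite ler_peMl// ltW.
  by move=> ? ?; lra.
have [big|small] := leP 1 `|n%:R * g - z%:~R|.
  by apply: le_trans en _; apply: le_trans e1 big.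
case: z z0 small => // m m0; rewrite -pmulrn => small.
have m0' : 0 < m%:R :> R by rewrite ltr0n.
have mle : m%:R <= (g + 1) * n%:R.
  by move: small; rewrite ltr_norml => /andP[]; lra.
have -> : `|n%:R * g - m%:R| = g * `|m%:R * alpha - n%:R|.
  rewrite (_ : _ - _ = - (g * (m%:R * alpha - n%:R))).
    by rewrite normrN normrM gtr0_norm.
  by rewrite /g; field; rewrite gt_eqF.
apply: (@le_trans _ _ (g * (c / m%:R ^+ t))); last first.
  by rewrite ler_pM2l// -[n%:R]/(n%:Z%:~R); apply: cF.
have mt : m%:R ^+ t <= (g + 1) ^+ t * n%:R ^+ t.
  by rewrite -exprMn lerXn2r// nnegrE ltW// mulr_gt0// ?addr_gt0// ltr0n.
rewrite ler_pdivrMr//; apply: le_trans ec _.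
rewrite ler_pdivrMr//.
have mt0 : 0 < m%:R ^+ t :> R by rewrite exprn_gt0.
rewrite (_ : _ * _ * _ = g * c * ((g + 1) ^+ t * n%:R ^+ t / m%:R ^+ t)); last by ring.
by rewrite ler_peMr ?ler_pdivlMr ?mul1r// ltW// mulr_gt0.
Qed.

End Diophantine.

(** * Power saving on the minor arcs *)

Section MinorArcs.
Context {R : realType}.
Implicit Types (gamma c D l phi x : R) (t P N q k b n X : nat).

(** Multiplication by [q] turns [n b] into an integer and leaves [n k gamma], so the loss against
    the hypothesis on [gamma] is a factor [q]. *)
Lemma far_ratio_le gamma c t q k b n q1 k1 n1 : 0 < c ->
  (forall n, (0 < n)%N -> far (c / n%:R ^+ t) (n%:R * gamma)) ->
  (0 < q <= q1)%N -> (0 < k <= k1)%N -> (0 < n <= n1)%N ->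
  far (c / (q1 * (n1 * k1) ^ t)%:R) (n%:R * ((k%:R * gamma + b%:R) / q%:R)).
Proof.
move=> c0 cF /andP[q0 qq] /andP[k0 kk] /andP[n0 nn] z.
have q0' : 0 < q%:R :> R by rewrite ltr0n.
have nk0 : 0 < (n * k)%:R ^+ t :> R by rewrite exprn_gt0// ltr0n muln_gt0 n0.
have := cF (n * k)%N _ (q%:Z * z - (n * b)%:Z); rewrite muln_gt0 n0 k0 => /(_ isT) H.
have -> : `|n%:R * ((k%:R * gamma + b%:R) / q%:R) - z%:~R| =
    q%:R^-1 * `|(n * k)%:R * gamma - (q%:Z * z - (n * b)%:Z)%:~R|.
  rewrite -[X in _ = X * _]gtr0_norm ?invr_gt0// -normrM; congr `|_|.
  rewrite rmorphB rmorphM /= -!pmulrn !natrM; field.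
  by rewrite gt_eqF.
apply: (@le_trans _ _ (q%:R^-1 * (c / (n * k)%:R ^+ t))); last first.
  by rewrite ler_pM2l ?invr_gt0.
rewrite natrM natrX invfM mulrCA; apply: ler_pM.
- by rewrite invr_ge0.
- by rewrite divr_ge0 ?exprn_ge0// ltW.
- by rewrite lef_pV2 ?posrE// ?ler_nat// ltr0n (leq_trans q0).
- rewrite ler_pM2l// lef_pV2 ?posrE//.
    by rewrite lerXn2r ?nnegrE// ler_nat leq_mul.
  by rewrite exprn_gt0// ltr0n muln_gt0 (leq_trans n0)// (leq_trans k0).
Qed.

(* Large enough for [U = L = P ^ 20] and [V = P ^ (20 + 26 t)] to be admissible in
   [sum_mangoldt_wave_le] when [P ^ type_exp t <= N]. *)
Definition type_exp t := (49 + 26 * t + (46 + 26 * t) * t)%N.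

(** The saving [P ^ 7] is one power more than the number [P ^ 6] of frequencies over which the bound
    is later multiplied. *)
Lemma minor_arc_le gamma c D l phi t P N q k b X : 0 < c ->
  (forall n, (0 < n)%N -> far (c / n%:R ^+ t) (n%:R * gamma)) ->
  1 <= D -> (0 < P)%N -> (P ^ type_exp t <= N)%N ->
  (0 < q <= P)%N -> (0 < k <= P ^ 6)%N ->
  (0 < X)%N -> 1 + ln X%:R <= l -> l <= D * P%:R -> X%:R <= D * P%:R * N%:R ->
  `|\sum_(1 <= n < X.+1)
      mangoldt n * tcos (n%:R * ((k%:R * gamma + b%:R) / q%:R) + phi)| <=
  (D + 2 * D / c + D + D ^+ 4 * (D + 1 + 2 / c)) * (N%:R / P%:R ^+ 7).
Proof.
move=> c0 cF D1 P0 PN qP kP X0 lX lD XD.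
set p : R := P%:R in lD XD *.
(* [e1] and [e2] are the powers of [P] lost in [far_ratio_le] for multipliers up to [U V] and up to
   [L], with [q <= P] and [k <= P ^ 6]. As [v = 19 + e2], the term [1 / (V d)] is [2 / c] times
   [P ^ -19]. *)
have [v vE] : exists v, v = (20 + 26 * t)%N by eexists.
have [e1 e1E] : exists e, e = (1 + (46 + 26 * t) * t)%N by eexists.
have [e2 e2E] : exists e, e = (1 + 26 * t)%N by eexists.
have p1 : 1 <= p by rewrite /p ler1n.
have p0 : 0 < p by apply: lt_le_trans p1.
have pp n : 0 < p ^+ n by rewrite exprn_gt0.
have ppN0 n : p ^+ n != 0 by rewrite gt_eqF.
have D0 : 0 < D by lra.
have N0 : 0 < N%:R :> R by rewrite ltr0n (leq_trans _ PN)// expn_gt0 P0.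
have lnX : 0 <= ln X%:R :> R by rewrite ln_ge0// ler1n.
have l0 : 0 <= l by lra.
have pN : p ^+ type_exp t <= N%:R by rewrite -natrX ler_nat.
pose d1 := c / p ^+ e1; pose d := c / p ^+ e2 / 2.
have d10 : 0 < d1 by rewrite divr_gt0.
have d0 : 0 < d by rewrite !divr_gt0.
(* The balancing parameter: [s l] is at most [D N / P ^ 7], and the other type II term has order
   [P ^ 4 N ^ 2 P ^ -19 / s], again [N / P ^ 7]. *)
pose s := N%:R / p ^+ 8; have s0 : 0 < s by rewrite divr_gt0.
have far1 n : (0 < n <= P ^ 20 * P ^ v)%N ->
    far d1 (n%:R * ((k%:R * gamma + b%:R) / q%:R)).
  move=> nUV; rewrite /d1 -natrX.
  rewrite (_ : (P ^ e1)%N = (P * ((P ^ 20 * P ^ v) * P ^ 6) ^ t)%N).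
    exact: far_ratio_le.
  by rewrite -!expnD -expnM -expnS; congr (_ ^ _)%N; rewrite e1E vE; clear; lia.
have far2 n : (0 < n <= P ^ 20)%N ->
    far (2 * d) (n%:R * ((k%:R * gamma + b%:R) / q%:R)).
  move=> nL; rewrite /d mulrC mulfVK// -natrX.
  rewrite (_ : (P ^ e2)%N = (P * (P ^ 20 * P ^ 6) ^ t)%N).
    exact: far_ratio_le.
  by rewrite -!expnD -expnM -expnS; congr (_ ^ _)%N; rewrite e2E; clear; lia.
have Pn n : (0 < P ^ n)%N by rewrite expn_gt0 P0.
apply: le_trans (@sum_mangoldt_wave_le R _ phi X (P ^ 20) (P ^ v) (P ^ 20) d1 d l s
  X0 (Pn _) (Pn _) (Pn _) d10 d0 s0 far1 far2 lX) _.
rewrite !natrX -/p.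
have T1 : p ^+ 20 * l + p ^+ v * (l / d1 + p ^+ 20 * l / d1) <=
    (D + 2 * D / c) * (N%:R / p ^+ 7).
  (* [v + e1 + 28] equals [type_exp t]: the type I sums fix that exponent. *)
  have E : p ^+ (v + e1 + 21) <= N%:R / p ^+ 7.
    rewrite ler_pdivlMr// -exprD; apply: le_trans pN.
    by rewrite ler_weXn2l// vE e1E /type_exp; clear; lia.
  apply: (@le_trans _ _ ((D + 2 * D / c) * p ^+ (v + e1 + 21))); last first.
    by rewrite ler_pM2l// addr_gt0// divr_gt0// mulr_gt0.
  rewrite mulrDl; apply: lerD.
    rewrite mulrC; apply: (@le_trans _ _ (D * p * p ^+ 20)); first by rewrite ler_pM2r.
    by rewrite -mulrA -exprS ler_pM2l// ler_weXn2l//; clear; lia.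
  apply: (@le_trans _ _ (p ^+ v * (D * p / d1 + p ^+ 20 * (D * p) / d1))).
    rewrite ler_pM2l//; apply: lerD; first by rewrite ler_pM2r ?invr_gt0.
    by rewrite ler_pM2r ?invr_gt0// ler_pM2l.
  have -> : p ^+ v * (D * p / d1 + p ^+ 20 * (D * p) / d1) =
      D / c * (p ^+ (v + e1 + 1) + p ^+ (v + e1 + 21)).
    rewrite /d1 !exprD -[p ^+ 21]/(p ^+ (20 + 1)) exprD !expr1.
    move: (ppN0 e1); move: (p ^+ v) (p ^+ e1) (p ^+ 20) => x y z y0.
    by field; rewrite y0 gt_eqF.
  have -> : 2 * D / c * p ^+ (v + e1 + 21) =
      D / c * (p ^+ (v + e1 + 21) + p ^+ (v + e1 + 21)) by ring.
  by rewrite ler_pM2l ?divr_gt0// lerD2r ler_weXn2l//; clear; lia.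
have T2 : s * l <= D * (N%:R / p ^+ 7).
  apply: (@le_trans _ _ (s * (D * p))); first by rewrite ler_pM2l.
  rewrite le_eqVlt; apply/orP; left; apply/eqP.
  rewrite /s -[8%N]/(7 + 1)%N exprD expr1.
  by move: (ppN0 7); move: (p ^+ 7) => y y0; field; rewrite y0 gt_eqF.
have T3 : l ^+ 2 * X%:R ^+ 2 * (l / p ^+ 20 + (p ^+ 20)^-1 + (p ^+ v * d)^-1) / s <=
    D ^+ 4 * (D + 1 + 2 / c) * (N%:R / p ^+ 7).
  have -> : D ^+ 4 * (D + 1 + 2 / c) * (N%:R / p ^+ 7) =
      (D * p) ^+ 2 * (D * p * N%:R) ^+ 2 *
      (D / p ^+ 19 + (p ^+ 19)^-1 + 2 / c / p ^+ 19) / s.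
    rewrite /s !exprMn -[19%N]/(7 + 12)%N -[12%N]/(8 + (2 + 2))%N !exprD.
    move: (ppN0 7) (ppN0 2) (ppN0 8); move: (p ^+ 7) (p ^+ 2) (p ^+ 8) => x y z x0 y0 z0.
    by field; rewrite x0 y0 z0 !gt_eqF.
  rewrite ler_pM2r ?invr_gt0//; apply: ler_pM.
  - by rewrite mulr_ge0 ?sqr_ge0.
  - rewrite !addr_ge0 ?invr_ge0 ?divr_ge0 ?(ltW (pp _))//.
    by rewrite mulr_ge0// ltW.
  - by apply: ler_pM; rewrite ?sqr_ge0// lerXn2r ?nnegrE// ltW// ?mulr_gt0.
  apply: lerD; first apply: lerD.
  - rewrite ler_pdivrMr// -[20%N]/(19 + 1)%N exprD expr1 mulrA.
    by rewrite mulfVK// (le_trans lD).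
  - by rewrite lef_pV2 ?posrE// ler_weXn2l.
  rewrite le_eqVlt; apply/orP; left; apply/eqP.
  have -> : v = (19 + e2)%N by rewrite vE e2E; clear; lia.
  rewrite /d exprD; move: (ppN0 19) (ppN0 e2); move: (p ^+ 19) (p ^+ e2) => x y x0 y0.
  by field; rewrite x0 y0 gt_eqF.
rewrite mulrDl [(_ + D) * _]mulrDl.
by apply: le_trans (lerD T1 (lerD T2 T3)) _; rewrite addrA.
Qed.

(** [sum_fpart_le] with [K = P ^ 6] and [J = P ^ 2], so that [1 / J] and [J ^ 2 / K] are both of
    order [P ^ -2]. The subtracted main term is free of [x]. *)
Lemma sum_mangoldt_fpart_le gamma c D l x t P N q a M : 0 < c ->
  (forall n, (0 < n)%N -> far (c / n%:R ^+ t) (n%:R * gamma)) ->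
  1 <= D -> (0 < P)%N -> (P ^ type_exp t <= N)%N -> (a < q <= P)%N ->
  1 + ln (q * M.+1)%:R <= l -> l <= D * P%:R -> M.+1%:R <= D * N%:R ->
  `|\sum_(1 <= m < M.+1) mangoldt (q * m + a) * fpart (x - m%:R * gamma) -
    (\sum_(1 <= m < M.+1) mangoldt (q * m + a)) *
      ((P ^ 6)%:R^-1 * \sum_(0 <= j < P ^ 6) j%:R / (P ^ 6)%:R)| <=
  (4 * (D + 2 * D / c + D + D ^+ 4 * (D + 1 + 2 / c)) + 4 * D + 131 * D ^+ 2) *
    (N%:R / P%:R).
Proof.
move=> c0 cF D1 P0 PN /andP[aq qP] lM lD MD.
set C := D + _ + _ + _; set p : R := P%:R in lD *.
have p1 : 1 <= p by rewrite /p ler1n.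
have p0 : 0 < p by apply: lt_le_trans p1.
have pp n : 0 < p ^+ n by rewrite exprn_gt0.
have ppN0 n : p ^+ n != 0 by rewrite gt_eqF.
have D0 : 0 < D by lra.
have q0 : (0 < q)%N by apply: leq_ltn_trans aq.
have N0 : 0 < N%:R :> R by rewrite ltr0n (leq_trans _ PN)// expn_gt0 P0.
have C0 : 0 <= C.
  by rewrite !addr_ge0 ?mulr_ge0 ?exprn_ge0 ?addr_ge0 ?mulr_ge0 ?invr_ge0 ?ltW.
have lnY n : (0 < n <= q * M.+1)%N -> 1 + ln n%:R <= l.
  move=> /andP[n0 nY]; apply: le_trans lM; rewrite lerD2l ler_ln ?posrE ?ltr0n//.
    by rewrite ler_nat.
  by rewrite muln_gt0 q0.
have l1 : 1 <= l by have := lnY 1%N; rewrite ln1 addr0 muln_gt0 q0 => /(_ isT).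
have wl m : (m <= M)%N -> mangoldt (q * m + a) <= l.
  move=> mM; have [->|n0] := posnP (q * m + a); first by rewrite (le_trans _ l1).
  apply: le_trans (mangoldt_le _ n0) _.
  have : 1 + ln (q * m + a)%:R <= l.
    by apply: lnY; rewrite n0 mulnS addnC leq_add ?leq_mul ?(ltnW aq).
  by lra.
(* The summand [l] pays for the term [m = 0], present in the progression sum but not here. *)
pose B := C * (N%:R / p ^+ 7) + l.
have B0 : 0 <= B by rewrite addr_ge0// ?(le_trans _ l1)// mulr_ge0// divr_ge0// ltW.
have wB h phi : (0 < h < P ^ 6)%N ->
    `|\sum_(1 <= m < M.+1) mangoldt (q * m + a) *
      tcos (h%:R * (x - m%:R * gamma) + phi)| <= B.
  move=> /andP[h0 hK]; pose psi := - (h%:R * x + phi).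
  have := @sum_mangoldt_progression_le R (h%:R * gamma) psi
    (C * (N%:R / p ^+ 7)) q a M aq.
  have tE m : tcos (h%:R * (x - m%:R * gamma) + phi) = tcos (m%:R * (h%:R * gamma) + psi).
    by rewrite -tcosN; congr tcos; rewrite /psi; ring.
  under [X in _ -> `|X| <= B]eq_bigr do rewrite tE.
  rewrite (big_ltn (ltn0Sn M)) => H.
  have {}H : `|mangoldt (q * 0 + a) * tcos (0%:R * (h%:R * gamma) + psi) +
      \sum_(1 <= m < M.+1) mangoldt (q * m + a) *
        tcos (m%:R * (h%:R * gamma) + psi)| <= C * (N%:R / p ^+ 7).
    apply: H => b phi' bq; have [X0|X0] := posnP (q * M + a).
      by rewrite X0 big_geq// normr0 mulr_ge0// divr_ge0// ltW.
    apply: (@minor_arc_le gamma c D l phi' t P) => //; rewrite ?q0 ?h0 ?(ltnW hK)//.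
      by apply: lnY; rewrite X0 mulnS addnC leq_add ?(ltnW aq).
    apply: (@le_trans _ _ (p * (D * N%:R))); last by rewrite mulrCA mulrA.
    apply: (@le_trans _ _ ((P * M.+1)%:R)); last by rewrite natrM ler_pM2l.
    rewrite ler_nat (leq_trans _ (leq_mul qP (leqnn _)))//.
    by rewrite mulnS addnC leq_add ?(ltnW aq).
  have w0 : `|mangoldt (q * 0 + a) * tcos (0%:R * (h%:R * gamma) + psi)| <= l.
    rewrite normrM -[l]mulr1; apply: ler_pM => //; last exact: tcos_norm_le1.
    by rewrite ger0_norm ?mangoldt_ge0// wl.
  rewrite -[X in `|X|](addKr (mangoldt (q * 0 + a) * tcos (0%:R * (h%:R * gamma) + psi))).
  apply: le_trans (ler_normD _ _) _; rewrite normrN /B addrC.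
  exact: lerD.
have K0 : (0 < P ^ 6)%N by rewrite expn_gt0 P0.
have JK : (0 < P ^ 2 <= P ^ 6)%N by rewrite expn_gt0 P0/= leq_pexp2l.
have := @sum_fpart_le R (fun m => mangoldt (q * m + a)) (fun m => x - m%:R * gamma)
  M (P ^ 6) B (fun m => mangoldt_ge0 _) K0 wB (P ^ 2) JK B0.
move=> /le_trans; apply; set W := \sum_(1 <= m < M.+1) _.
(* Bounding each weight by [l] loses a factor [P], which is why an error of order [P ^ -2] is
   needed. *)
have Wle : W <= D * N%:R * (D * p).
  apply: (@le_trans _ _ (\sum_(1 <= m < M.+1) l)).
    by apply: ler_sum_nat => m /andP[_ mM]; exact: wl.
  rewrite big_const_nat iter_addr_0 subSS subn0 -[l *+ M]mulr_natl.
  apply: ler_pM => //; first by lra.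
  by apply: le_trans MD; rewrite ler_nat.
have -> : (8 * (P ^ 2)%:R)^-1 + 128 * (P ^ 2)%:R ^+ 2 / (P ^ 6)%:R +
    5 / (2 * (P ^ 2)%:R) = (1 / 8 + 128 + 5 / 2) / p ^+ 2 :> R.
  rewrite !natrX -/p -exprM -[6%N]/(2 + 2 * 2)%N exprD.
  move: (ppN0 2) (ppN0 (2 * 2)%N); move: (p ^+ 2) (p ^+ (2 * 2)) => y z y0 z0.
  by field; rewrite y0 z0.
have T1 : W * ((1 / 8 + 128 + 5 / 2) / p ^+ 2) <= 131 * D ^+ 2 * (N%:R / p).
  apply: (@le_trans _ _ (D * N%:R * (D * p) * (131 / p ^+ 2))).
    apply: ler_pM => //.
    - by apply: sumr_ge0 => m _; exact: mangoldt_ge0.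
    - by rewrite divr_ge0// ltW.
    - by rewrite ler_pM2r ?invr_gt0//; lra.
  rewrite le_eqVlt; apply/orP; left; apply/eqP; field.
  by rewrite gt_eqF.
have T2 : ((P ^ 6)%:R + 3) * B <= 4 * (C + D) * (N%:R / p).
  have pN : p ^+ 8 <= N%:R.
    apply: (@le_trans _ _ (p ^+ type_exp t)); last by rewrite -natrX ler_nat.
    by rewrite ler_weXn2l// /type_exp; clear; lia.
  have lB : l <= D * (N%:R / p ^+ 7).
    by apply: le_trans lD _; rewrite ler_pM2l// ler_pdivlMr// -exprS.
  apply: (@le_trans _ _ (4 * p ^+ 6 * ((C + D) * (N%:R / p ^+ 7)))).
    apply: ler_pM => //.
    - rewrite natrX -/p; have : 1 <= p ^+ 6 by rewrite exprn_ege1.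
      by lra.
    - by apply: (le_trans (lerD (lexx _) lB)); rewrite -mulrDl.
  rewrite le_eqVlt; apply/orP; left; apply/eqP.
  rewrite -[7%N]/(6 + 1)%N exprD expr1; move: (ppN0 6); move: (p ^+ 6) => y y0.
  by field; rewrite y0 gt_eqF.
apply: le_trans (lerD T2 T1) _.
by rewrite -mulrDl [4 * (C + D)]mulrDr.
Qed.

End MinorArcs.

(** * Counting in Beatty sequences *)

Section BeattyCount.
Context {R : realType}.
Implicit Types (alpha beta x : R) (N m n : nat) (z u v : int).

Lemma sum_ltz N z : (\sum_(1 <= n < N.+1) (n%:Z < z)%R)%N =
  minn N (if (0 < z)%R then `|z|.-1 else 0)%N.
Proof.
elim: N => [|N IH]; first by rewrite big_geq// min0n.
by rewrite big_nat_recr//= IH; case: (ltP (N.+1%:Z) z); case: (ltP 0 z); lia.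
Qed.

(** The bounds are the ceilings of [(z - beta) / alpha] and [(z + 1 - beta) / alpha], written as
    [- floor (- _)] so that [fpart] comes out directly. *)
Lemma floor_eqE alpha beta n z : 0 < alpha ->
  (Num.floor (alpha * n%:R + beta) == z) =
  (- Num.floor (alpha^-1 * (beta - z%:~R)) <= n%:Z <
   - Num.floor (alpha^-1 * (beta - (z + 1)%:~R))).
Proof.
move=> a0; have H w : (w%:~R <= alpha * n%:R + beta) =
    (- Num.floor (alpha^-1 * (beta - w%:~R)) <= n%:Z).
  rewrite lerNl floor_ge_int [alpha^-1 * _]mulrC ler_pdivlMr// rmorphN /= -pmulrn.
  by apply/idP/idP; lra.
by rewrite floor_eq H [(_ < _)%R]ltNge [X in ~~ X]H -ltNge.
Qed.

(** The solutions [n] form the interval [[u, v)]. Restricting to [1 <= n <= N] can only lose some,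
    and loses none if the interval lies inside. *)
Lemma count_floor_eq alpha beta N z u v : 0 < alpha ->
  u = - Num.floor (alpha^-1 * (beta - z%:~R)) ->
  v = - Num.floor (alpha^-1 * (beta - (z + 1)%:~R)) ->
  (\sum_(1 <= n < N.+1) (Num.floor (alpha * n%:R + beta) == z) : nat)%:Z <= v - u /\
  (0 < u -> v <= N.+1%:Z ->
   (\sum_(1 <= n < N.+1) (Num.floor (alpha * n%:R + beta) == z) : nat)%:Z = v - u).
Proof.
move=> a0 uE vE; have uv : u <= v.
  rewrite uE vE lerN2; apply: le_floor; rewrite ler_pM2l ?invr_gt0// lerD2l lerN2.
  by rewrite ler_int; lia.
have E : (\sum_(1 <= n < N.+1) (Num.floor (alpha * n%:R + beta) == z) +
    \sum_(1 <= n < N.+1) (n%:Z < u)%R = \sum_(1 <= n < N.+1) (n%:Z < v)%R)%N.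
  rewrite -big_split /=; apply: eq_bigr => n _.
  by rewrite floor_eqE// -uE -vE; case: (ltP n%:Z u); case: (ltP n%:Z v); lia.
rewrite !sum_ltz in E; set s := (\sum_(_ <= _ < _) _)%N in E *.
by split; move: E; case: ifP; case: ifP; lia.
Qed.

End BeattyCount.

(** * Reduction of the Beatty sum to fractional parts *)

Section Beatty.
Context {R : realType}.
Implicit Types (alpha beta D l : R) (a q N M m n : nat).

Lemma sum_floor_count alpha beta N M (w : int -> R) :
  0 < alpha ->
  (forall z, (z < 0)%R -> w z = 0) -> Num.floor (alpha * N%:R + beta) <= M%:Z ->
  \sum_(1 <= n < N.+1) w (Num.floor (alpha * n%:R + beta)) =
  \sum_(0 <= m < M.+1) w m%:Z *
    (\sum_(1 <= n < N.+1) (Num.floor (alpha * n%:R + beta) == m%:Z))%N%:R.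
Proof.
move=> a0 w0 FM; under [RHS]eq_bigr do rewrite natr_sum mulr_sumr.
rewrite exchange_big /=; apply: eq_big_nat => n /andP[_ nN].
have : Num.floor (alpha * n%:R + beta) <= M%:Z.
  apply: le_trans FM; apply: le_floor; rewrite lerD2r ler_pM2l// ler_nat -ltnS.
  exact: nN.
case: (Num.floor _) => [k kM|k _]; last first.
  by rewrite w0// big1// => m _; rewrite mulr0.
rewrite (eq_bigr (fun m => if m == k then w k else 0)); last first.
  move=> m _; rewrite eqz_nat eq_sym; case: eqP => [->|_]; by rewrite ?mulr1 ?mulr0.
by rewrite -big_mkcond big_nat1_eq ifT//= ltnS -lez_nat.
Qed.

(** Replacing each count by its exact length [g + fpart (x m.+1) - fpart (x m)] is an error only
    where the interval may leave [[1, N]]: for [m < m0] at the lower end and [m = M] at the upper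
    end. With the separate term [m = 0] this makes at most [m0 + 2] errors, each at most
    [l (g + 1)]. *)
Lemma beatty_error_le alpha beta l a q N M :
  0 < alpha -> (a < q)%N -> 1 + ln (q * M.+1)%:R <= l ->
  (Num.floor (alpha * N%:R + beta) = M%:Z \/
   Num.floor (alpha * N%:R + beta) < 0 /\ M = 0%N) ->
  `| \sum_(1 <= n < N.+1)
       von_mangoldt (q%:Z * Num.floor (alpha * n%:R + beta) + a%:Z)
     - alpha^-1 * \sum_(1 <= m < M.+1) mangoldt (q * m + a)
     - (\sum_(1 <= m < M.+1) mangoldt (q * m + a) *
          fpart (alpha^-1 * (beta - 1) - m%:R * alpha^-1)
        - \sum_(1 <= m < M.+1) mangoldt (q * m + a) *
          fpart (alpha^-1 * beta - m%:R * alpha^-1))| <=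
  l * (alpha^-1 + 1) * (`|Num.floor beta|%N.+1 + 2)%:R.
Proof.
move=> a0 aq lM FM; set g := alpha^-1; have g0 : 0 < g by rewrite invr_gt0.
have q0 : (0 < q)%N by apply: leq_ltn_trans aq.
pose w (z : int) : R := von_mangoldt (q%:Z * z + a%:Z).
have wE m : w m%:Z = mangoldt (q * m + a) by rewrite /w -PoszM -PoszD.
have w0 z : z < 0 -> w z = 0.
  move=> z0; rewrite /w; have : q%:Z * z + a%:Z < 0 by nia.
  by case: (_ + _).
have l1 : 1 <= l.
  by apply: le_trans lM; rewrite lerDl ln_ge0// ler1n muln_gt0 q0.
have wl m : (m <= M)%N -> mangoldt (q * m + a) <= l.
  move=> mM; have [->|n0] := posnP (q * m + a); first by rewrite (le_trans _ l1).
  apply: le_trans (mangoldt_le _ n0) _.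
  have : ln (q * m + a)%:R <= ln (q * M.+1)%:R :> R.
    rewrite ler_ln ?posrE ?ltr0n ?muln_gt0 ?q0// ler_nat.
    by rewrite mulnS addnC leq_add ?leq_mul ?(ltnW aq).
  by lra.
pose x m : R := g * (beta - m%:R).
pose A m : int := - Num.floor (x m).
pose c m : nat := (\sum_(1 <= n < N.+1) (Num.floor (alpha * n%:R + beta) == m%:Z))%N.
have AE m : (A m)%:~R = fpart (x m) - x m by rewrite /A /fpart rmorphN /=; ring.
have gap m : (A m.+1)%:~R - (A m)%:~R = g + fpart (x m.+1) - fpart (x m).
  by rewrite !AE /x -natr1; ring.
have gap_le m : (A m.+1)%:~R - (A m)%:~R <= g + 1.
  rewrite gap; have /andP[_] := fpart_itv (x m.+1).
  by have /andP[+ _] := fpart_itv (x m); lra.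
have cA m : (c m)%:Z <= A m.+1 - A m /\ (0 < A m -> A m.+1 <= N.+1%:Z ->
    (c m)%:Z = A m.+1 - A m).
  apply: (@count_floor_eq R alpha beta) => //; rewrite /A /x -?pmulrn//.
  by rewrite rmorphD /= -natr1.
pose e m : R := (c m)%:R - ((A m.+1)%:~R - (A m)%:~R).
have e_le0 m : e m <= 0.
  rewrite /e subr_le0 -rmorphB /= pmulrn ler_int; exact: (cA m).1.
have e_ge m : - (g + 1) <= e m.
  by have := gap_le m; have : 0 <= (c m)%:R :> R by []; rewrite /e; lra.
(* From [m0] on, [m] exceeds [beta], so [x m] is negative and the interval starts at a positive
   integer. *)
set m0 := `|Num.floor beta|%N.+1.
have e_eq0 m : (m0 <= m)%N -> (m < M)%N -> e m = 0.
  move=> m0m mM; rewrite /e -rmorphB /= -(cA m).2 ?subrr//.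
    rewrite /A oppr_gt0 -(ltr_int R) (le_lt_trans (floor_le _))//.
    rewrite /x pmulr_rlt0// subr_lt0.
    have := floorD1_gt beta => /lt_le_trans; apply.
    rewrite pmulrn ler_int; move: m0m; rewrite /m0.
    by move: (Num.floor beta) => z; lia.
  case: FM => [FM|[_ M0]]; last by rewrite M0 in mM.
  suff : A m.+1 <= N%:Z by lia.
  have FN := floor_le (alpha * N%:R + beta); rewrite FM in FN.
  rewrite /A lerNl floor_ge_int rmorphN /= -!pmulrn /x /g mulrC ler_pdivlMr//.
  have : m.+1%:R <= M%:R :> R by rewrite ler_nat.
  by move: FN; rewrite -pmulrn; lra.
have FM' : Num.floor (alpha * N%:R + beta) <= M%:Z.
  by case: FM => [->|[/ltW FM ->]].
rewrite (sum_floor_count _ _ _ _ w a0 w0 FM').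
rewrite (big_ltn (ltn0Sn M)) wE muln0 add0n -/(c 0%N).
have -> : mangoldt a * (c 0%N)%:R +
    \sum_(1 <= m < M.+1) w m%:Z * (c m)%:R
     - g * \sum_(1 <= m < M.+1) mangoldt (q * m + a)
     - (\sum_(1 <= m < M.+1) mangoldt (q * m + a) *
          fpart (g * (beta - 1) - m%:R * g)
        - \sum_(1 <= m < M.+1) mangoldt (q * m + a) *
          fpart (g * beta - m%:R * g)) =
    mangoldt a * (c 0%N)%:R + \sum_(1 <= m < M.+1) mangoldt (q * m + a) * e m.
  rewrite -!addrA; congr (_ + _); rewrite mulr_sumr -!sumrB addrA -!sumrB.
  apply: eq_bigr => m _; rewrite wE /e gap.
  rewrite (_ : g * (beta - 1) - m%:R * g = x m.+1); last by rewrite /x -natr1; ring.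
  rewrite (_ : g * beta - m%:R * g = x m); last by rewrite /x; ring.
  by ring.
have c0 : (c 0%N)%:R <= g + 1.
  by have := e_le0 0%N; have := gap_le 0%N; rewrite /e; lra.
have g1 : 0 <= g + 1 by rewrite addr_ge0// ltW.
have l0 : 0 <= l by lra.
apply: le_trans (ler_normD _ _) _.
have T0 : `|mangoldt a * (c 0%N)%:R| <= l * (g + 1).
  rewrite ger0_norm ?mulr_ge0 ?mangoldt_ge0//; apply: ler_pM => //.
    exact: mangoldt_ge0.
  by have := wl 0%N isT; rewrite muln0 add0n.
have T1 : `|\sum_(1 <= m < M.+1) mangoldt (q * m + a) * e m| <=
    l * (g + 1) * (m0 + 1)%:R.
  apply: (@le_trans _ _ (\sum_(1 <= m < M.+1)
      (l * (g + 1)) * ((m < m0)%:R + (m == M)%:R))).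
    apply: le_trans (ler_norm_sum _ _ _) _.
    apply: ler_sum_nat => m /andP[_]; rewrite ltnS => mM; rewrite normrM.
    have em : `|e m| <= g + 1 by rewrite ler_norml e_ge (le_trans (e_le0 m)).
    have wm : `|mangoldt (q * m + a)| <= l by rewrite ger0_norm ?mangoldt_ge0// wl.
    have wem : `|mangoldt (q * m + a)| * `|e m| <= l * (g + 1) by apply: ler_pM.
    have lg : 0 <= l * (g + 1) by apply: mulr_ge0.
    have [mm|mm] := ltnP m m0; rewrite mulrDr ?mulr1.
      by apply: le_trans wem _; rewrite lerDl mulr_ge0.
    have [mME|mME] := eqVneq m M; first by rewrite mulr0 add0r mulr1.
    by rewrite e_eq0 ?normr0 ?mulr0 ?addr0// ltn_neqAle mME.
  rewrite -mulr_sumr ler_wpM2l ?mulr_ge0// big_split /= -!natr_sum natrD lerD//.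
    rewrite ler_nat; suff : (\sum_(1 <= i < M.+1) (i < m0) <= minn M m0)%N.
      by move=> /leq_trans; apply; rewrite geq_minr.
    elim: (M) => [|k IH]; first by rewrite big_geq.
    rewrite big_nat_recr//=; move: IH; set s := (\sum_(_ <= _ < _) _)%N.
    by move: (m0) => j; lia.
  rewrite (ler_nat _ _ 1) (eq_bigr (fun m => if m == M then 1%N else 0%N)).
    by rewrite -big_mkcond big_nat1_eq; case: ifP.
  by move=> m _; case: eqP.
apply: le_trans (lerD T0 T1) _.
rewrite (_ : (m0 + 2)%:R = 1 + (m0 + 1)%:R) ?mulrDr ?mulr1//.
by rewrite addrC natr1 addn1 addn2.
Qed.

End Beatty.

(** * Choice of the parameters and conclusion *)

Lemma one_add_ln_le (R : realType) (D y p : R) (A n : nat) : 1 <= D ->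
  1 <= y -> 1 <= p -> y <= 2 * p -> (0 < n)%N -> n%:R <= y * (D * y ^+ A) ->
  1 + ln n%:R <= (1 + ln D + A%:R * 2 + 1) * p.
Proof.
move=> D1 y1 p1 yp n0 nle; have y0 : 0 < y by lra.
have D0 : 0 < D by lra.
have yA0 : 0 < y ^+ A by rewrite exprn_gt0.
have lnD : 0 <= ln D by rewrite ln_ge0.
have A0 : 0 <= A%:R :> R by [].
(* With [y = N^kappa] and [p = P], this trades every logarithm for a factor [P]. *)
have lny : ln y <= 2 * p - 1.
  have : ln (1 + (y - 1)) <= y - 1 by apply: le_ln1Dx; lra.
  by rewrite (addrC 1) subrK; lra.
have : ln n%:R <= ln (y * (D * y ^+ A)).
  by rewrite ler_ln// posrE ?ltr0n// !mulr_gt0.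
rewrite !lnM ?posrE ?mulr_gt0// lnXn// -[_ *+ A]mulr_natl.
have : A%:R * ln y <= A%:R * (2 * p - 1) by rewrite ler_wpM2l.
have : ln D <= ln D * p by rewrite ler_peMr.
by move: (ln y) (ln D) (ln n%:R) lny => u v w ? ? ? ?; lra.
Qed.

Theorem theorem5p1 (R : realType) (alpha beta : R) :
  0 < alpha -> irrational alpha -> finite_type alpha ->
  exists2 kappa : R, 0 < kappa &
  exists C : R, forall N a q : nat,
    (1 <= N)%N -> (a < q)%N -> q%:R <= N%:R `^ kappa -> coprime a q ->
    let M : int := Num.floor (alpha * N%:R + beta) in
    `| \sum_(1 <= n < N.+1)
          von_mangoldt (q%:Z * Num.floor (alpha * n%:R + beta) + a%:Z)
       - alpha^-1 * \sum_(1 <= m < `|M|%N.+1 | m%:Z <= M)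
                       von_mangoldt (q%:Z * m%:Z + a%:Z) |
    <= C * N%:R `^ (1 - kappa).
Proof.
move=> a0 airr aft; have [t [c' [c'0 c'F]]] := finite_type_far _ airr aft.
have [c c0 cF] := far_inv _ _ _ a0 c'0 c'F.
set g := alpha^-1 in cF *; have g0 : 0 < g by rewrite invr_gt0.
have [A AE] : exists A, A = type_exp t by eexists.
have A0 : (0 < A)%N by rewrite AE.
have A0' : 0 < A%:R :> R by rewrite ltr0n.
(* Then [y = N^kappa] satisfies [y ^ A = N], so its integer part [P] satisfies
   [P ^ type_exp t <= N]. *)
pose kappa : R := A%:R^-1; exists kappa; first by rewrite invr_gt0.
pose D1 := alpha + `|beta| + 1.
have D1_ge1 : 1 <= D1 by rewrite lerDr addr_ge0// ltW.
have D1_gt0 : 0 < D1 by lra.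
(* One constant for two bounds: [D1] controls the length [M' + 1] against [N], the bracket controls
   the logarithm [l] against [P]. *)
pose D := D1 + (1 + ln D1 + A%:R * 2 + 1).
have lnD1 : 0 <= ln D1 by rewrite ln_ge0.
have D1D : D1 <= D by rewrite /D lerDl; have := ltW A0'; lra.
have D_ge1 : 1 <= D by apply: le_trans D1D.
pose E := 4 * (D + 2 * D / c + D + D ^+ 4 * (D + 1 + 2 / c)) + 4 * D + 131 * D ^+ 2.
pose F := D * (g + 1) * (`|Num.floor beta|%N.+1 + 2)%:R.
(* [E] is paid for each of the two fractional parts and [F] for the ends of the Beatty count; the
   outer 2 comes from [N / P <= 2 N^(1 - kappa)]. *)
exists (2 * (2 * E + F)); move=> N a q N1 aq qN _; cbv zeta.
set M := Num.floor (alpha * N%:R + beta).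
have N0 : 0 < N%:R :> R by rewrite ltr0n.
have N1' : 1 <= N%:R :> R by rewrite ler1n.
set y := N%:R `^ kappa in qN.
have y0 : 0 <= y by exact: powR_ge0.
have y1 : 1 <= y.
  by rewrite -(powRr0 N%:R) /y; apply: ler_powR; rewrite ?invr_ge0.
have yA : y ^+ A = N%:R.
  by rewrite -powR_mulrn// -powRrM mulVf ?gt_eqF// powRr1.
pose P := Num.truncn y.
have /andP[Py yP] : P%:R <= y < P.+1%:R by exact: truncn_itv.
have P0 : (0 < P)%N by rewrite -ltnS -(ltr_nat R); apply: le_lt_trans yP.
have p1 : 1 <= P%:R :> R by rewrite ler1n.
have p0 : 0 < P%:R :> R by rewrite ltr0n.
have yp2 : y <= 2 * P%:R by move: yP; rewrite -natr1; lra.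
have qP : (q <= P)%N by rewrite -ltnS -(ltr_nat R); apply: le_lt_trans yP.
have q0 : (0 < q)%N by apply: leq_ltn_trans aq.
have PN : (P ^ A <= N)%N.
  by rewrite -(ler_nat R) natrX -yA lerXn2r// nnegrE.
have NP : N%:R / P%:R <= 2 * N%:R `^ (1 - kappa).
  rewrite powRB; last by rewrite (gt_eqF N0) implybT.
  rewrite powRr1 ?(ltW N0)// -/y mulrCA ler_pM2l// ler_pdivlMr; last by lra.
  by rewrite mulrC ler_pdivrMr.
(* For negative [M] the sum over [m <= M] is empty although its range up to the absolute value of
   [M] is not; [M' = 0] reflects this. *)
pose M' : nat := if 0 <= M then `|M|%N else 0%N.
have MM' : M = M'%:Z \/ M < 0 /\ M' = 0%N.
  by rewrite /M'; case: leP => M0; [left; rewrite gez0_abs | right].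
have M'N : M'.+1%:R <= D1 * N%:R.
  have FM := floor_le (alpha * N%:R + beta); rewrite -/M in FM.
  rewrite -natr1 /D1 !mulrDl mul1r lerD//.
  have bN : `|beta| <= `|beta| * N%:R by rewrite ler_peMr.
  have aN : 0 <= alpha * N%:R by rewrite mulr_ge0// ltW.
  case: MM' => [ME|[_ ->]]; last by rewrite addr_ge0// mulr_ge0.
  rewrite pmulrn -ME; apply: le_trans FM _; rewrite lerD2l.
  by apply: le_trans (ler_norm _) bN.
have -> : \sum_(1 <= m < `|M|%N.+1 | m%:Z <= M) von_mangoldt (q%:Z * m%:Z + a%:Z) =
    \sum_(1 <= m < M'.+1) mangoldt (q * m + a) :> R.
  case: MM' => [ME|[M0 ->]]; last first.
    by rewrite [RHS]big_geq// big1// => m /le_lt_trans/(_ M0).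
  rewrite ME big_nat_cond [RHS]big_nat; apply: eq_big => m; last first.
    by move=> _; rewrite -PoszM -PoszD.
  by rewrite /= ltnS lez_nat -andbA andbb.
pose l := 1 + ln (q * M'.+1)%:R : R.
have lD : l <= D * P%:R.
  apply: (@le_trans _ _ ((1 + ln D1 + A%:R * 2 + 1) * P%:R)).
    apply: (@one_add_ln_le _ D1 y) => //; first by rewrite muln_gt0 q0.
    by rewrite natrM yA; apply: ler_pM.
  by rewrite ler_pM2r// /D lerDr ltW.
rewrite AE in PN.
have M'D : M'.+1%:R <= D * N%:R by apply: le_trans M'N _; rewrite ler_pM2r.
have aqP : (a < q <= P)%N by rewrite aq.
have main x := @sum_mangoldt_fpart_le R g c D l x t P N q a M' c0 cF D_ge1 P0 PN
  aqP (lexx l) lD M'D.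
have m1 := main (g * (beta - 1)); have m2 := main (g * beta).
have err := beatty_error_le alpha beta l a q N M' a0 aq (lexx _) MM'.
rewrite -/g in err.
have errF : l * (g + 1) * (`|Num.floor beta|%N.+1 + 2)%:R <= F * (N%:R / P%:R).
  have lN : l <= D * (N%:R / P%:R).
    apply: le_trans lD _; rewrite ler_pM2l; last by lra.
    rewrite ler_pdivlMr// -natrM ler_nat (leq_trans _ PN)//.
    by rewrite -[(P * P)%N]/(P ^ 2)%N leq_pexp2l// /type_exp; clear; lia.
  rewrite (_ : F * _ = D * (N%:R / P%:R) * (g + 1) *
    (`|Num.floor beta|%N.+1 + 2)%:R); last by rewrite /F; ring.
  by rewrite !ler_pM2r ?addr_gt0// ltr0n.
have NP0 : 0 < N%:R / P%:R :> R by rewrite divr_gt0.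
have E0 : 0 <= E by rewrite -(pmulr_lge0 _ NP0); apply: le_trans m1.
have F0 : 0 <= F.
  by rewrite -(pmulr_lge0 _ NP0); apply: le_trans errF; apply: le_trans err.
apply: (@le_trans _ _ ((2 * E + F) * (N%:R / P%:R))); last first.
  rewrite [2 * (2 * E + F)]mulrC -[leRHS]mulrA; apply: ler_wpM2l => //.
  by apply: addr_ge0 => //; exact: mulr_ge0.
move: err m1 m2; rewrite -/E.
set s := \sum_(_ <= _ < _) _; set r := _ * \sum_(_ <= _ < _) _.
set s1 := \sum_(_ <= _ < _) _; set s2 := \sum_(_ <= _ < _) _.
set w := (\sum_(_ <= _ < _) _) * (_ * _); set Z := N%:R / P%:R in errF *.
set b := l * _ * _ in errF *.
move=> err m1 m2.
(* The mean term [w] is common to both fractional part sums and drops out. *)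
have -> : s - r = (s - r - (s1 - s2)) + (s1 - w) - (s2 - w) by ring.
apply: le_trans (ler_normB _ _) _; apply: le_trans (lerD (ler_normD _ _) (lexx _)) _.
apply: le_trans (lerD (lerD err m1) m2) _.
apply: (le_trans (lerD (lerD errF (lexx _)) (lexx _))).
rewrite le_eqVlt; apply/orP; left; apply/eqP.
by move: (E) (F) (Z) => u v x'; ring.
Qed.
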